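(* Let $\alpha\in K^{(2)}$ be a quadratic power series and let $m$ be an integer such that $q^{-m}\in \mathrm{Sp}(\alpha)$. Then there exists a quadratic power series $f\in K^{(2)}\setminus\Theta_\alpha$ such that $c_\alpha(f)=q^{-m}$.
   Context: Let $q$ be a positive power of a prime, $\mathbb F_q$ the field with $q$ elements, $R=\mathbb F_q[Y]$, $K=\mathbb F_q(Y)$, and $\widehat K=\mathbb F_q((Y^{-1}))$, the completion of $K$ for the absolute value $|P/Q|=q^{\deg P-\deg Q}$ ($P,Q\in R\setminus\{0\}$), extended to $\widehat K$. Let $K^{(2)}=\{f\in\widehat K: [K(f):K]=2\}$ (quadratic power series). For $\alpha\in K^{(2)}$, $\alpha^\sigma$ denotes its Galois conjugate over $K$ (well defined and distinct from $\alpha$, also in characteristic 2). The group $\mathrm{PGL}_2(R)$ acts on $\widehat K\cup\{\infty\}$ by homographies; set $\Theta_\alpha=\mathrm{PGL}_2(R)\cdot\{\alpha,\alpha^\sigma\}$. For $f\in\widehat K\setminus(K\cup\Theta_\alpha)$ define $c_\alpha(f)=\liminf_{\beta\in\Theta_\alpha,\ |\beta-\beta^\sigma|\to0}\frac{|f-\beta|}{|\beta-\beta^\sigma|}$, and the quadratic Lagrange spectrum $\mathrm{Sp}(\alpha)=\{c_\alpha(f): f\in\widehat K\setminus(K\cup\Theta_\alpha)\}$. *)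

(* Defs.v *)
From HB Require Import structures.
From mathcomp Require Import all_boot all_order all_algebra.
From mathcomp Require Import boolp classical_sets constructive_ereal reals ereal.

Set Implicit Arguments.
Unset Strict Implicit.
Unset Printing Implicit Defensive.

Import Order.TTheory GRing.Theory Num.Theory.
Local Open Scope ring_scope.
Local Open Scope classical_set_scope.

(** * Laurent series  \hat K = F_q((Y^{-1}))

  An element of \hat K is represented by its coefficient function
  [f : int -> F], [f n] being the coefficient of [Y^n]; it must vanish for
  all large [n] (predicate [laurent]).  R = F_q[Y] is [{poly F}] and
  is embedded by [lpoly]. *)

Definition lser (F : finFieldType) := int -> F.

Section Laurent.
Variable F : finFieldType.

Definition laurent (f : lser F) : Prop :=
  exists N : int, forall n : int, N < n -> f n = 0.

Definition lzero : lser F := fun _ => 0.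
Definition ladd (f g : lser F) : lser F := fun n => f n + g n.
Definition lopp (f : lser F) : lser F := fun n => - f n.
Definition lsub (f g : lser F) : lser F := ladd f (lopp g).

Definition lpoly (p : {poly F}) : lser F :=
  fun n => match n with Posz k => p`_k | Negz _ => 0 end.

(** some upper bound of the support (any bound gives the same product) *)
Definition lbound (f : lser F) : int :=
  xget 0 (fun N : int => forall n : int, N < n -> f n = 0).

Definition tonat (z : int) : nat :=
  match z with Posz k => k | Negz _ => 0%N end.

(** Cauchy product: (fg)_n = sum_{i + j = n} f_i g_j, a finite sum *)
Definition lmul (f g : lser F) : lser F :=
  fun n => let bf := lbound f in let bg := lbound g in
  \sum_(k < tonat (bf + bg - n + 1)) f (bf - k%:Z) * g (n - bf + k%:Z).

Definition ldeg (f : lser F) : int :=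
  xget 0 (fun N : int => f N != 0 /\ forall n : int, N < n -> f n = 0).

Definition labs (R : realType) (f : lser F) : R :=
  if `[< f = lzero >] then 0 else (#|F|%:R : R) ^ (ldeg f).

Definition inK (f : lser F) : Prop :=
  exists P Q : {poly F}, Q != 0 /\ lmul (lpoly Q) f = lpoly P.

Definition lquadform (A B C : {poly F}) (f : lser F) : lser F :=
  ladd (ladd (lmul (lpoly A) (lmul f f)) (lmul (lpoly B) f)) (lpoly C).

Definition quadratic (f : lser F) : Prop :=
  laurent f /\ ~ inK f /\
  exists A B C : {poly F}, A != 0 /\ lquadform A B C f = lzero.

Definition galconj (f : lser F) : lser F :=
  xget f (fun g : lser F => laurent g /\ g <> f /\
    forall A B C : {poly F}, lquadform A B C f = lzero -> lquadform A B C g = lzero).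

Definition homography (M : 'M[{poly F}]_2) (gamma beta : lser F) : Prop :=
  let den := ladd (lmul (lpoly (M 1 0)) gamma) (lpoly (M 1 1)) in
  den <> lzero /\
  lmul den beta = ladd (lmul (lpoly (M 0 0)) gamma) (lpoly (M 0 1)).

Definition Theta (alpha : lser F) : set (lser F) :=
  [set beta | laurent beta /\
    exists M : 'M[{poly F}]_2, M \in unitmx /\
      exists gamma, (gamma = alpha \/ gamma = galconj alpha) /\
        homography M gamma beta].

(** c_alpha(f) = liminf_{beta in Theta_alpha, |beta - beta^sigma| -> 0}
      |f - beta| / |beta - beta^sigma|
    written as  sup_{eps > 0} inf_{beta in Theta, |beta - beta^sigma| < eps}. *)
Definition calpha (R : realType) (alpha f : lser F) : \bar R :=
  ereal_sup [set ereal_inf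
      [set ((labs R (lsub f beta)) / (labs R (lsub beta (galconj beta))))%:E
        | beta in [set beta | Theta alpha beta /\
                     labs R (lsub beta (galconj beta)) < eps]]
    | eps in [set eps : R | 0 < eps]].

Definition Sp (R : realType) (alpha : lser F) : set (\bar R) :=
  [set calpha R alpha f | f in [set f | laurent f /\ ~ inK f /\ ~ Theta alpha f]].

End Laurent.

Arguments labs {F} R f.
Arguments calpha {F} R alpha f.
Arguments Sp {F} R alpha _.

(* Main.v *)
Require Import Defs.
From HB Require Import structures.
From mathcomp Require Import all_boot all_order all_algebra.
From mathcomp Require Import boolp classical_sets constructive_ereal reals ereal.
From mathcomp Require Import zify ring lra.

(** For a pair (b, b^s) of conjugate points of Theta_alpha, |f - b| / |b - b^s| is the
  norm of the cross-ratio of (oo, f, b, b^s), hence GL_2(R)-invariant as a function of the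
  "line" (oo, f) and of the pair.  Since the norm takes values in q^Z, c_alpha(f) = k means
  that the cross-ratio is >= k for all pairs with |b - b^s| small, and equal to k for
  pairs with |b - b^s| arbitrarily small.

  Write the continued fraction expansion as f = G_n x_n with |x_n| > 1 and
  |y_n| = |G_n^-1 oo| < 1.  By the pigeonhole principle there are n < m such that
  (1/x_n, y_n) and (1/x_m, y_m) are close.  The matrix h = G_n^-1 G_m is then
  hyperbolic, with an attracting fixed point w and a repelling fixed point e, and its axis
  (e, w) follows the line (y_n, x_n) = G_n^-1 (oo, f) along a full period of h and a bit
  beyond.  Any pair violating the lower bound along (e, w) can be moved into that period by
  a power of h, hence gives a pair violating it along (oo, f); and a pair realizing k along
  (oo, f) inside that period realizes k along (e, w) too, together with all its translates
  by the powers of h.  So the quadratic series w has the same constant as f.  That w is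
  not in Theta_alpha follows from the local finiteness of the set of pairs: otherwise the
  pair (w, e) itself would come too close to (oo, f). *)

Set Implicit Arguments.
Unset Strict Implicit.
Unset Printing Implicit Defensive.

Import Order.TTheory GRing.Theory Num.Theory.
Local Open Scope ring_scope.
Local Open Scope classical_set_scope.

(** * The Cauchy product *)

Section CauchyProduct.
Variable F : finFieldType.
Implicit Types (f g h : lser F) (a b n : int).

Definition vanishes_above a f := forall n, a < n -> f n = 0.

Lemma lboundP f : laurent f -> vanishes_above (Defs.lbound f) f.
Proof. by move=> fN; exact: (xgetPex 0 fN). Qed.

Lemma vanishes_aboveW a b f : a <= b -> vanishes_above a f -> vanishes_above b f.
Proof. by move=> ab fa n bn; apply: fa; exact: le_lt_trans bn. Qed.

Lemma cauchy_sum_shift a f g n (d k : nat) : vanishes_above a f ->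
  \sum_(i < d + k) f (a + d%:Z - i%:Z) * g (n - (a + d%:Z) + i%:Z)
  = \sum_(i < k) f (a - i%:Z) * g (n - a + i%:Z).
Proof.
move=> fa; rewrite big_split_ord /= big1 ?add0r => [|i _]; last first.
  by rewrite fa ?mul0r //; have := ltn_ord i; lia.
by apply: eq_bigr => i _; congr (f _ * g _); lia.
Qed.

Lemma cauchy_sum_widen a b f g n (k l : nat) :
  vanishes_above b g -> a + b - n < k%:Z -> (k <= l)%N ->
  \sum_(i < l) f (a - i%:Z) * g (n - a + i%:Z)
  = \sum_(i < k) f (a - i%:Z) * g (n - a + i%:Z).
Proof.
move=> gb kn /subnKC <-; rewrite big_split_ord /= [X in _ + X]big1 ?addr0 // => i _.
by rewrite gb ?mulr0 //; lia.
Qed.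

(** [lmul] uses bounds obtained by choice, so its sum must be compared with one built on other
    bounds. Raising the bound of [f] prepends zero terms, lengthening the sum appends zero terms;
    padding brings both sums to a common shape. *)
Lemma lmulE a b f g n (k : nat) : vanishes_above a f -> vanishes_above b g ->
  a + b - n < k%:Z ->
  lmul f g n = \sum_(i < k) f (a - i%:Z) * g (n - a + i%:Z).
Proof.
move=> fa gb kn.
have Hf : vanishes_above (Defs.lbound f) f by apply: lboundP; exists a.
have Hg : vanishes_above (Defs.lbound g) g by apply: lboundP; exists b.
rewrite /lmul; move: (Defs.lbound f) (Defs.lbound g) Hf Hg => a' b' Hf Hg.
set k' := tonat _.
have k'n : a' + b' - n < k'%:Z by rewrite /k'; case E: (_ - n + 1) => /=; lia.
pose A := Num.max a a'.
pose l := (`|a|%N + `|a'|%N + k + k')%N.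
rewrite -(@cauchy_sum_widen a' b' f g n k' l) //; last by rewrite /l; lia.
rewrite -(@cauchy_sum_widen a b f g n k l) //; last by rewrite /l; lia.
case: (leP a a') => aa'.
  have [d ad] : exists d : nat, a' = a + d%:Z by exists `|a' - a|%N; lia.
  rewrite -(@cauchy_sum_shift a f g n d l) // -ad.
  rewrite (@cauchy_sum_widen a' b' f g n l (d + l)) //; rewrite /l; lia.
have [d ad] : exists d : nat, a = a' + d%:Z by exists `|a' - a|%N; lia.
rewrite -(@cauchy_sum_shift a' f g n d l) // -ad.
rewrite (@cauchy_sum_widen a b f g n l (d + l)) //; rewrite /l; lia.
Qed.

Lemma lmul_vanishes a b f g : vanishes_above a f -> vanishes_above b g ->
  vanishes_above (a + b) (lmul f g).
Proof. by move=> fa gb n abn; rewrite (lmulE (k := 0) fa gb) ?big_ord0 //; lia. Qed.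

(** Coefficients are read downwards from degree [a]: this is a truncated power series in 1/Y, so
    ring laws of [{poly F}] carry over one coefficient at a time. *)
Definition ltrunc a f (k : nat) : {poly F} := \poly_(i < k) f (a - i%:Z).

Lemma lmul_coef a b f g (k j : nat) : vanishes_above a f -> vanishes_above b g ->
  (j < k)%N -> lmul f g (a + b - j%:Z) = (ltrunc a f k * ltrunc b g k)`_j.
Proof.
move=> fa gb jk; rewrite (lmulE (k := j.+1) fa gb) ?coefM; last by lia.
apply: eq_bigr => i _; have := ltn_ord i => ij.
rewrite !coef_poly; have -> : (i < k)%N by lia.
have -> : (j - i < k)%N by lia.
by congr (_ * g _); lia.
Qed.

Lemma coefM_congr (p p' r r' : {poly F}) (j : nat) :
  (forall i, (i <= j)%N -> p`_i = p'`_i) -> (forall i, (i <= j)%N -> r`_i = r'`_i) ->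
  (p * r)`_j = (p' * r')`_j.
Proof.
move=> pp rr; rewrite !coefM; apply: eq_bigr => i _.
by have := ltn_ord i => ij; rewrite pp ?rr //; lia.
Qed.

Lemma coef_ltrunc_lmul a b f g (k i : nat) :
  vanishes_above a f -> vanishes_above b g -> (i < k)%N ->
  (ltrunc (a + b) (lmul f g) k)`_i = (ltrunc a f k * ltrunc b g k)`_i.
Proof. by move=> fa gb ik; rewrite coef_poly ik (lmul_coef fa gb ik). Qed.

Lemma lmulA f g h : laurent f -> laurent g -> laurent h ->
  lmul f (lmul g h) = lmul (lmul f g) h.
Proof.
move=> [a fa] [b gb] [c hc]; apply/funext => n.
case: (leP n (a + b + c)) => nabc; last first.
  rewrite (lmul_vanishes (lmul_vanishes fa gb) hc) //.
  by rewrite (lmul_vanishes fa (lmul_vanishes gb hc)) ?addrA.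
have [j ->] : exists j : nat, n = a + b + c - j%:Z by exists (absz (a + b + c - n)%R); lia.
rewrite (lmul_coef (k := j.+1) (lmul_vanishes fa gb) hc) // -!addrA.
rewrite [b + _]addrA addrA (lmul_coef (k := j.+1) fa (lmul_vanishes gb hc)) //.
transitivity ((ltrunc a f j.+1 * (ltrunc b g j.+1 * ltrunc c h j.+1))`_j).
  by apply: coefM_congr => // i ij; rewrite coef_ltrunc_lmul.
rewrite mulrA; symmetry; apply: coefM_congr => // i ij.
by rewrite coef_ltrunc_lmul.
Qed.

Lemma lmulC f g : laurent f -> laurent g -> lmul f g = lmul g f.
Proof.
move=> [a fa] [b gb]; apply/funext => n.
case: (leP n (a + b)) => nab; last first.
  by rewrite (lmul_vanishes fa gb) // (lmul_vanishes gb fa) // addrC.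
have [j ->] : exists j : nat, n = a + b - j%:Z by exists (absz (a + b - n)%R); lia.
by rewrite (lmul_coef (k := j.+1) fa gb) // [a + b]addrC
  (lmul_coef (k := j.+1) gb fa) // mulrC.
Qed.

Lemma laddM f g h : laurent f -> laurent g -> laurent h ->
  lmul (ladd f g) h = ladd (lmul f h) (lmul g h).
Proof.
move=> [a fa] [b gb] [c hc]; apply/funext => n; rewrite /ladd.
have fA : vanishes_above (Num.max a b) f by apply: vanishes_aboveW fa; lia.
have gA : vanishes_above (Num.max a b) g by apply: vanishes_aboveW gb; lia.
have fgA : vanishes_above (Num.max a b) (ladd f g).
  by move=> i ?; rewrite /ladd fA // gA // addr0.
move: (Num.max a b) fA gA fgA => A fA gA fgA.
have [k kn] : exists k : nat, A + c - n < k%:Z by exists (absz (A + c - n)%R).+1; lia.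
rewrite (lmulE fgA hc kn) (lmulE fA hc kn) (lmulE gA hc kn) -big_split /=.
by apply: eq_bigr => i _; rewrite mulrDl.
Qed.

Lemma lpoly_vanishes (p : {poly F}) : vanishes_above ((size p)%:Z - 1) (lpoly p).
Proof.
case=> // k kp; rewrite /lpoly nth_default //.
have {}kp : (size p)%:Z < k%:Z + 1 by rewrite -ltrBlDr.
by move: kp; rewrite -PoszD ltz_nat addn1 ltnS.
Qed.

Lemma lpoly_neg (p : {poly F}) n : n < 0 -> lpoly p n = 0.
Proof. by case: n. Qed.

Lemma laurent_poly (p : {poly F}) : laurent (lpoly p).
Proof. by exists ((size p)%:Z - 1); exact: lpoly_vanishes. Qed.

Lemma laurent_mul f g : laurent f -> laurent g -> laurent (lmul f g).
Proof. by move=> [a fa] [b gb]; exists (a + b); exact: lmul_vanishes. Qed.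

Lemma laurent_add f g : laurent f -> laurent g -> laurent (ladd f g).
Proof.
move=> [a fa] [b gb]; exists (Num.max a b) => n abn.
by rewrite /ladd fa ?gb ?addr0 //; lia.
Qed.

Lemma laurent_opp f : laurent f -> laurent (lopp f).
Proof. by move=> [a fa]; exists a => n an; rewrite /lopp fa ?oppr0. Qed.

Lemma lpoly1_mul f : laurent f -> lmul (lpoly 1) f = f.
Proof.
move=> [a fa]; apply/funext => n.
have p1 : vanishes_above 0 (lpoly (1 : {poly F})).
  by case=> // -[|k] _ //=; rewrite coef1.
have [k kn] : exists k : nat, 0 + a - n < k.+1%:Z by exists (absz (0 + a - n)%R); lia.
rewrite (lmulE p1 fa kn) big_ord_recl big1 ?addr0 => [|i _].
  by rewrite /= coef1 mul1r; congr f; lia.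
by rewrite lpoly_neg ?mul0r // lift0; lia.
Qed.

Lemma lpolyM (p r : {poly F}) : lpoly (p * r) = lmul (lpoly p) (lpoly r).
Proof.
have rv := lpoly_vanishes (p := r); have pv := lpoly_vanishes (p := p).
move: (size p) (size r) pv rv => sp sr pv rv.
apply/funext => -[n|n]; last first.
  rewrite (lmulE (k := sp + sr + n) pv rv) //=; last by lia.
  rewrite big1 // => i _.
  case E: (_ - i%:Z) => [j|j]; last by rewrite mul0r.
  case E': (_ + i%:Z) => [j'|j']; last by rewrite mulr0.
  by lia.
(* With the bound raised to n + sp, the sum splits into three blocks: in the first the index of [r]
   is negative, in the last that of [p] is, and the middle one is the polynomial product. *)
have pv' : vanishes_above (n%:Z + (sp)%:Z) (lpoly p).
  by apply: vanishes_aboveW pv; lia.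
rewrite (lmulE (k := sp + (n.+1 + sr)) pv' rv) //; last by lia.
rewrite big_split_ord /= big1 ?add0r => [|i _]; last first.
  have := ltn_ord i => ip.
  by case E': (_ + i%:Z) => [j'|j']; rewrite ?mulr0 //; lia.
rewrite big_split_ord /= [X in _ + X]big1 ?addr0 => [|i _]; last first.
  by case E': (_ - _) => [j'|j']; rewrite ?mul0r //; lia.
rewrite coefMr; apply: eq_bigr => i _; have := ltn_ord i => ip.
rewrite (_ : _ - (sp + i)%:Z = (n - i)%:Z); last by lia.
by rewrite (_ : _ + (sp + i)%:Z = i%:Z) //; lia.
Qed.

End CauchyProduct.

(** * The field of Laurent series and its norm *)

Record laurent_series (F : finFieldType) :=
  LaurentSeries { lcoef :> int -> F; lcoefP : laurent lcoef }.

Section LaurentField.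
Variable F : finFieldType.
Local Notation LS := (laurent_series F).
Implicit Types x y z : LS.

HB.instance Definition _ := gen_eqMixin LS.
HB.instance Definition _ := gen_choiceMixin LS.

Lemma lcoef_inj x y : lcoef x = lcoef y -> x = y.
Proof.
case: x y => [f fP] [g gP] /= fg; rewrite fg in fP *.
by rewrite (Prop_irrelevance fP gP).
Qed.

Lemma laurent_zero : laurent (@lzero F).
Proof. by exists 0. Qed.

Definition ls_zero : LS := LaurentSeries laurent_zero.
Definition ls_one : LS := LaurentSeries (laurent_poly 1).
Definition ls_add x y : LS := LaurentSeries (laurent_add (lcoefP x) (lcoefP y)).
Definition ls_opp x : LS := LaurentSeries (laurent_opp (lcoefP x)).
Definition ls_mul x y : LS := LaurentSeries (laurent_mul (lcoefP x) (lcoefP y)).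

Fact ls_addA : associative ls_add.
Proof. by move=> x y z; apply/lcoef_inj/funext => n; exact: addrA. Qed.
Fact ls_addC : commutative ls_add.
Proof. by move=> x y; apply/lcoef_inj/funext => n; exact: addrC. Qed.
Fact ls_add0 : left_id ls_zero ls_add.
Proof. by move=> x; apply/lcoef_inj/funext => n; exact: add0r. Qed.
Fact ls_addN : left_inverse ls_zero ls_opp ls_add.
Proof. by move=> x; apply/lcoef_inj/funext => n; exact: addNr. Qed.
HB.instance Definition _ := GRing.isZmodule.Build LS ls_addA ls_addC ls_add0 ls_addN.

Fact ls_mulA : associative ls_mul.
Proof. by move=> x y z; apply/lcoef_inj/lmulA; exact: lcoefP. Qed.
Fact ls_mulC : commutative ls_mul.
Proof. by move=> x y; apply/lcoef_inj/lmulC; exact: lcoefP. Qed.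
Fact ls_mul1 : left_id ls_one ls_mul.
Proof. by move=> x; apply/lcoef_inj/lpoly1_mul; exact: lcoefP. Qed.
Fact ls_mulD : left_distributive ls_mul ls_add.
Proof. by move=> x y z; apply/lcoef_inj/laddM; exact: lcoefP. Qed.
Fact ls_one_neq0 : ls_one != ls_zero.
Proof.
apply/eqP => /(congr1 (fun x : LS => x 0)) /=; rewrite coef1 => /eqP.
by rewrite oner_eq0.
Qed.
HB.instance Definition _ := GRing.Zmodule_isComNzRing.Build LS
  ls_mulA ls_mulC ls_mul1 ls_mulD ls_one_neq0.

Lemma lcoefD x y n : (x + y) n = x n + y n. Proof. by []. Qed.
Lemma lcoefB x y n : (x - y) n = x n - y n. Proof. by []. Qed.
Lemma lcoefM x y : lcoef (x * y) = lmul x y. Proof. by []. Qed.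

Definition small x := vanishes_above (-1) x.

(** Banach's fixed point theorem on the open unit ball: a factor [k] of degree at most -1 means that
    each application of [Phi] settles one more coefficient. *)
Lemma contraction_fixpoint (Phi : LS -> LS) :
  (forall x, small x -> small (Phi x)) ->
  (forall x y, small x -> small y ->
     exists2 k, small k & Phi x - Phi y = k * (x - y)) ->
  exists2 x, small x & Phi x = x.
Proof.
move=> PhiS PhiC.
pose agree (N : nat) x y := forall n : int, - N%:Z <= n -> x n = y n.
have agreeS N x y : small x -> small y -> agree N x y -> agree N.+1 (Phi x) (Phi y).
  move=> xS yS xy n Nn; have [k kS kE] := PhiC _ _ xS yS.
  apply/eqP; rewrite -subr_eq0 -lcoefB kE lcoefM; apply/eqP.
  have dv : vanishes_above (- N%:Z - 1) (x - y).
    by move=> i iN; rewrite lcoefB xy ?subrr //; lia.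
  by apply: (lmul_vanishes kS dv); lia.
pose X k := iter k Phi 0.
have XS k : small (X k) by elim: k => // k IH; exact: PhiS.
have agree0 x y : small x -> small y -> agree 0%N x y.
  by move=> xS yS n n0; rewrite xS ?yS //; lia.
have agreeX k j : agree k (X k) (X (k + j)%N).
  elim: k => [|k IH]; first exact: agree0.
  by rewrite addSn; exact: agreeS.
(* Diagonal limit: the coefficient of index n no longer changes after |n| iterations. *)
pose f : lser F := fun n => X (absz n) n.
have fS : vanishes_above (-1) f by move=> n n1; rewrite /f XS.
have fP : laurent f by exists (-1).
pose x := LaurentSeries fP.
have xX k : agree k x (X k).
  move=> n kn; rewrite -[x n]/(f n).
  have [n0|n0] := leP 0 n.
    by have n1 : -1 < n by [lia]; rewrite fS // (XS k n).
  have nk : (absz n <= k)%N by lia.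
  by rewrite /f (agreeX (absz n) (k - absz n)%N) ?subnKC //; lia.
exists x => //; apply/lcoef_inj/funext => n; set k := absz n.
have kn : - k%:Z <= n by lia.
rewrite (agreeS k x (X k) fS (XS _) (xX k)); last by lia.
by rewrite -[Phi (X k)]/(X k.+1) -xX //; lia.
Qed.

Lemma ls_leading x : x != 0 ->
  exists2 d, x d != 0 & vanishes_above d x.
Proof.
case: (lcoefP x) => a xa x0.
have [k kx] : exists k : nat, x (a - k%:Z) != 0.
  apply: contrapT => nk; move/eqP: x0; apply; apply/lcoef_inj/funext => n.
  case: (leP n a) => na; last by rewrite xa.
  apply: contrapT => /eqP xn; apply: nk; exists (absz (a - n)%R).
  by rewrite (_ : a - _ = n) //; lia.
pose m := ex_minn (ex_intro (fun k : nat => x (a - k%:Z) != 0) k kx).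
exists (a - m%:Z); rewrite /m; case: ex_minnP => //= i xi imin n an.
case: (leP n a) => na; last by rewrite xa.
apply: contrapT => /eqP xn; have := imin (absz (a - n)%R).
by rewrite (_ : a - (absz (a - n)%R)%:Z = n) ?xn; [lia|lia].
Qed.

(** Multiplying by the inverse [m] of the leading monomial turns [x] into 1 - r with r small. The
    geometric series 1/(1 - r) is 1 + v, where v is the fixed point of v -> r + r v. *)
Lemma ls_inv_ex x : x != 0 -> exists y, y * x = 1.
Proof.
move=> /ls_leading [d xd xv].
have mP : laurent (fun n : int => if n == - d then (x d)^-1 else 0).
  by exists (- d) => n dn; rewrite gt_eqF.
pose m := LaurentSeries mP.
have mv : vanishes_above (- d) m by move=> n dn; rewrite /= gt_eqF.
pose r := 1 - m * x.
have rS : small r.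
  move=> n n1; have := lmul_vanishes mv xv => mxv.
  case: (ltgtP n 0) => n0; first by lia.
    rewrite lcoefB lcoefM mxv ?subr0; last by lia.
    by case: n {n1} n0 => // -[|k] //= _; rewrite coef1.
  rewrite n0 lcoefB lcoefM.
  have := @lmul_coef _ (- d) d m x 1 0 mv xv isT.
  rewrite (_ : - d + d - 0%:Z = 0); last by lia.
  by move=> ->; rewrite coef0M !coef_poly /= subr0 eqxx subr0 mulVf // coef1 subrr.
have [v vS vE] : exists2 v, small v & r + r * v = v.
  apply: (@contraction_fixpoint (fun v => r + r * v)) => [v vS n n1|v w vS wS].
    rewrite lcoefD rS // add0r lcoefM; apply: (lmul_vanishes rS vS); lia.
  by exists r => //; ring.
have mx : m * x = 1 - r by rewrite /r subKr.
exists ((1 + v) * m); rewrite -mulrA mx.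
have -> : (1 + v) * (1 - r) = 1 + v - (r + r * v) by ring.
by rewrite vE addrK.
Qed.

Definition ls_inv x : LS :=
  if pselect (x = 0) is left _ then 0 else xget 0 [set y | y * x = 1].

Fact ls_mulVf x : x != 0 -> ls_inv x * x = 1.
Proof.
move=> x0; rewrite /ls_inv; case: pselect => [xe|_]; first by rewrite xe eqxx in x0.
exact: (xgetPex 0 (ls_inv_ex x0)).
Qed.
Fact ls_inv0 : ls_inv 0 = 0.
Proof. by rewrite /ls_inv; case: pselect. Qed.
HB.instance Definition _ := GRing.ComNzRing_isField.Build LS ls_mulVf ls_inv0.

Definition ls_poly (p : {poly F}) : LS := LaurentSeries (laurent_poly p).

Fact ls_polyB : {morph ls_poly : p q / p - q}.
Proof.
by move=> p q; apply/lcoef_inj/funext => -[k|k];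
  rewrite lcoefB /= ?coefB ?subr0.
Qed.
Fact ls_polyM : {morph ls_poly : p q / p * q}.
Proof. by move=> p q; apply/lcoef_inj; exact: lpolyM. Qed.
Fact ls_poly_monoid : monoid_morphism ls_poly.
Proof. by split; [exact: lcoef_inj | exact: ls_polyM]. Qed.
HB.instance Definition _ := GRing.isZmodMorphism.Build {poly F} LS ls_poly ls_polyB.
HB.instance Definition _ := GRing.isMonoidMorphism.Build {poly F} LS ls_poly ls_poly_monoid.

Lemma ls_poly_inj : injective ls_poly.
Proof.
by move=> p q pq; apply/polyP => k; have := congr1 (fun x : LS => x k) pq.
Qed.

Lemma ls_poly_eq0 p : (ls_poly p == 0) = (p == 0).
Proof. by rewrite -(inj_eq ls_poly_inj) rmorph0. Qed.

End LaurentField.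

(** * The ultrametric norm on Laurent series *)

Section LaurentNorm.
Variables (F : finFieldType) (R : realType).
Local Notation LS := (laurent_series F).
Local Notation q := (#|F|%:R : R).
Implicit Types x y z : LS.

Lemma card_gt1 : 1 < q.
Proof. by rewrite ltr1n; exact: card_finNzRing_gt1. Qed.

Definition lnorm x : R := labs R x.

Lemma exprq_gt0 (d : int) : 0 < q ^ d.
Proof. by rewrite exprz_gt0 // (lt_trans _ card_gt1). Qed.

Lemma lnorm_eq x d : x d != 0 -> vanishes_above d x -> lnorm x = q ^ d.
Proof.
move=> xd xv; rewrite /lnorm /labs; case: asboolP => [xe|_].
  by rewrite xe eqxx in xd.
congr (_ ^ _); rewrite /ldeg.
have [ed ev] := @xgetPex _ (0 : int) (fun N : int => x N != 0 /\ forall n : int, N < n -> x n = 0)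
  (ex_intro _ d (conj xd xv)).
case: (ltgtP (xget 0 (fun N : int => x N != 0 /\ forall n : int, N < n -> x n = 0)) d) => //.
  by move=> /ev dx; rewrite dx eqxx in xd.
by move=> /xv dx; rewrite dx eqxx in ed.
Qed.

Lemma lnorm0 : lnorm 0 = 0.
Proof. by rewrite /lnorm /labs; case: asboolP. Qed.

Lemma lnorm_ex x : x != 0 -> exists d, lnorm x = q ^ d.
Proof. by move=> /ls_leading[d xd xv]; exists d; exact: lnorm_eq. Qed.

Lemma lnorm_eq0 x : lnorm x = 0 -> x = 0.
Proof.
move=> x0; apply/eqP; apply: contraT => /lnorm_ex[d xd].
by have := exprq_gt0 d; rewrite -xd x0 ltxx.
Qed.

Lemma lnorm_le x d : (lnorm x <= q ^ d) <-> vanishes_above d x.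
Proof.
have [->|x0] := eqVneq x 0.
  by rewrite lnorm0; split => // _; exact/ltW/exprq_gt0.
have [e xe xv] := ls_leading x0; rewrite (lnorm_eq xe xv).
rewrite ler_eXz2l ?card_gt1 //; split => [ed|xvd]; first exact: vanishes_aboveW xv.
by rewrite leNgt; apply/negP => /xvd /eqP; exact/negP.
Qed.

Lemma lnorm_ge0 x : 0 <= lnorm x.
Proof.
have [->|/lnorm_ex[d ->]] := eqVneq x 0; first by rewrite lnorm0.
exact/ltW/exprq_gt0.
Qed.

Lemma lnormM x y : lnorm (x * y) = lnorm x * lnorm y.
Proof.
have [->|/ls_leading[a xa xv]] := eqVneq x 0; first by rewrite mul0r lnorm0 mul0r.
have [->|/ls_leading[b yb yv]] := eqVneq y 0; first by rewrite mulr0 lnorm0 mulr0.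
rewrite (lnorm_eq xa xv) (lnorm_eq yb yv) -expfzDr; last first.
  by rewrite gt_eqF // (lt_trans _ card_gt1).
apply: lnorm_eq; last exact: lmul_vanishes.
have := @lmul_coef _ a b x y 1 0 xv yv isT; rewrite subr0 lcoefM => ->.
by rewrite coef0M !coef_poly /= !subr0 mulf_neq0.
Qed.

Lemma lnormD x y : lnorm (x + y) <= Num.max (lnorm x) (lnorm y).
Proof.
wlog xy : x y / lnorm x <= lnorm y.
  by move=> H; case/orP: (le_total (lnorm x) (lnorm y)) => /H //; rewrite addrC maxC.
rewrite max_r //.
have [y0|/lnorm_ex[d yd]] := eqVneq y 0; first by rewrite y0 addr0 -y0.
rewrite yd in xy *; apply/lnorm_le => n dn; rewrite lcoefD.
by rewrite (lnorm_le x d).1 // (lnorm_le y d).1 ?yd ?addr0.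
Qed.

Lemma lnorm_poly (p : {poly F}) : p != 0 -> lnorm (ls_poly p) = q ^+ (size p).-1.
Proof.
move=> p0; rewrite (@lnorm_eq _ (size p).-1%:Z) //.
- by rewrite /= -/(lead_coef p) lead_coef_eq0.
- apply: vanishes_aboveW (lpoly_vanishes (p := p)).
  by rewrite lerBlDr -PoszD lez_nat addn1 leqSpred.
Qed.

Lemma lnorm_poly_ge1 (p : {poly F}) : p != 0 -> 1 <= lnorm (ls_poly p).
Proof. by move=> /lnorm_poly ->; rewrite exprn_ege1 // ltW // card_gt1. Qed.

Lemma lnorm_floor x : exists p : {poly F}, lnorm (x - ls_poly p) < 1.
Proof.
have [a xa] := lcoefP x; exists (\poly_(i < (absz a).+1) x i%:Z).
have -> : (1 : R) = q ^ 0 by [].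
rewrite -[0](subrK 1 0) sub0r; apply: (@le_lt_trans _ _ (q ^ (-1))).
  apply/lnorm_le => -[n _|n n1]; last by lia.
  rewrite lcoefB /= coef_poly; case: ltnP => nk; first by rewrite subrr.
  by rewrite subr0 xa //; lia.
by rewrite ltr_eXz2l // card_gt1.
Qed.

End LaurentNorm.

(** * Cross-ratios and homographies over an ultrametric field *)

(** The comparison of axes below uses only these axioms; Laurent series come back once homographies
    have polynomial entries. *)
Record ultrametric_norm (R : realType) (K : fieldType) (N : K -> R) : Prop := {
  un_ge0 : forall x, 0 <= N x;
  un0 : N 0 = 0;
  un_eq0 : forall x, N x = 0 -> x = 0;
  unM : forall x y, N (x * y) = N x * N y;
  unD : forall x y, N (x + y) <= Num.max (N x) (N y) }.

Section Ultrametric.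
Variables (R : realType) (K : fieldType) (N : K -> R).
Hypothesis NP : ultrametric_norm N.
Implicit Types x y z w e b u : K.

Lemma un_gt0 x : x != 0 -> 0 < N x.
Proof.
move=> x0; rewrite lt_neqAle (un_ge0 NP) andbT eq_sym.
by apply: contra x0 => /eqP /(un_eq0 NP) ->.
Qed.

Lemma un1 : N 1 = 1.
Proof.
have n1 : N 1 != 0 by rewrite gt_eqF // un_gt0 // oner_neq0.
by apply: (mulIf n1); rewrite -(unM NP) !mul1r.
Qed.

Lemma unN x : N (- x) = N x.
Proof.
rewrite -mulN1r (unM NP); suff -> : N (-1) = 1 by rewrite mul1r.
have : (N (-1)) ^+ 2 = 1 by rewrite expr2 -(unM NP) mulrNN mul1r un1.
by move/eqP; rewrite sqrf_eq1 => /orP[/eqP //|/eqP n1]; have := un_ge0 NP (-1);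
  rewrite n1; lra.
Qed.

Lemma unV x : N x^-1 = (N x)^-1.
Proof.
have [->|x0] := eqVneq x 0; first by rewrite invr0 (un0 NP) invr0.
have n0 : N x != 0 by rewrite gt_eqF // un_gt0.
by apply: (mulIf n0); rewrite -(unM NP) !mulVf // un1.
Qed.

Lemma un_div x y : N (x / y) = N x / N y.
Proof. by rewrite (unM NP) unV. Qed.

Lemma unBC x y : N (x - y) = N (y - x).
Proof. by rewrite -unN opprB. Qed.

Lemma unB_le x y (t : R) : N x <= t -> N y <= t -> N (x - y) <= t.
Proof.
by move=> xt yt; rewrite (le_trans (unD NP _ _)) // ge_max xt unN yt.
Qed.

Lemma unB_lt x y (t : R) : N x < t -> N y < t -> N (x - y) < t.
Proof.
by move=> xt yt; rewrite (le_lt_trans (unD NP _ _)) // gt_max xt unN yt.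
Qed.

Lemma unD_lt x y (t : R) : N x < t -> N y < t -> N (x + y) < t.
Proof. by move=> xt yt; rewrite (le_lt_trans (unD NP _ _)) // gt_max xt yt. Qed.

(** Isosceles triangle principle: otherwise x = (x + y) - y would be too small. *)
Lemma unD_dom x y : N y < N x -> N (x + y) = N x.
Proof.
move=> yx; apply/eqP; rewrite eq_le; apply/andP; split.
  by rewrite (le_trans (unD NP _ _)) // ge_max lexx ltW.
rewrite leNgt; apply/negP => xyx.
by have := unB_lt xyx yx; rewrite addrK ltxx.
Qed.

Lemma unB_doml x y : N y < N x -> N (x - y) = N x.
Proof. by move=> yx; rewrite unD_dom // unN. Qed.

Lemma unB_domr x y : N x < N y -> N (x - y) = N y.
Proof. by move=> yx; rewrite unBC unB_doml. Qed.

Lemma un_sub_eq0 x y : x != y -> 0 < N (x - y).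
Proof. by move=> xy; rewrite un_gt0 // subr_eq0. Qed.

(* Both quantities are absolute values of cross-ratios: [rho e w b b'] is that of
   (e, w, b, b'), and [rho_oo w b b'] is the case where [e] is the point at infinity. *)
Definition rho e w b b' : R := N (w - b) * N (e - b') / (N (b - b') * N (e - w)).
Definition rho_oo w b b' : R := N (w - b) / N (b - b').

(** Seen from [e], the points [b'] and [w] are at the same distance, so [e] may be sent to
    infinity. *)
Lemma rho_oo_near e w b b' : e != w -> N (b' - w) < N (e - w) ->
  rho e w b b' = rho_oo w b b'.
Proof.
move=> ew bw; rewrite /rho /rho_oo.
have -> : N (e - b') = N (e - w).
  have -> : e - b' = (e - w) - (b' - w) by ring.
  exact: unB_doml.
by rewrite -mulf_div divff ?mulr1 // gt_eqF // un_sub_eq0.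
Qed.

(** The coordinate that sends [e] to 0 and [w] to infinity; a homography fixing both points acts on
    it as a multiplication. *)
Definition axis_coord e w z := (z - e) / (z - w).

Lemma axis_coordB e w b b' : b != w -> b' != w ->
  axis_coord e w b - axis_coord e w b' = (b - b') * (e - w) / ((b - w) * (b' - w)).
Proof. by rewrite /axis_coord -!(subr_eq0 _ w) => ? ?; field; apply/andP. Qed.

Lemma axis_coordB_norm e w b b' : b != w -> b' != w ->
  N (axis_coord e w b - axis_coord e w b')
  = N (b - b') * N (e - w) / (N (b - w) * N (b' - w)).
Proof. by move=> bw bw'; rewrite axis_coordB // un_div !(unM NP). Qed.

Lemma rho_axis e w b b' : e != w -> b != w -> b' != w -> b != b' ->
  rho e w b b' = N (axis_coord e w b') / N (axis_coord e w b - axis_coord e w b').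
Proof.
move=> ew bw bw' bb; rewrite axis_coordB_norm // un_div /rho.
rewrite (unBC w) (unBC e b').
have := (un_sub_eq0 ew, un_sub_eq0 bw, un_sub_eq0 bw', un_sub_eq0 bb).
by move=> [[[? ?] ?] ?]; field; rewrite !gt_eqF.
Qed.

Lemma rho_coord e w x y b b' :
  e != w -> x != w -> y != w -> b != w -> b' != w -> b != b' -> x != y ->
  rho y x b b' = rho (axis_coord e w y) (axis_coord e w x)
                     (axis_coord e w b) (axis_coord e w b').
Proof.
move=> ew xw yw bw bw' bb xy; rewrite /rho !axis_coordB_norm //.
have yx : y != x by rewrite eq_sym.
have := (un_sub_eq0 ew, un_sub_eq0 bw, un_sub_eq0 bw', un_sub_eq0 bb,
  un_sub_eq0 xw, un_sub_eq0 yw, un_sub_eq0 yx).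
by move=> [[[[[[? ?] ?] ?] ?] ?] ?]; field; rewrite !gt_eqF.
Qed.

Lemma rho_between y x u u' : N y < N u' -> N u < N x -> N y < N x ->
  rho y x u u' = N u' / N (u - u').
Proof.
move=> yu ux yx; rewrite /rho (unB_doml ux) (unB_domr yu) (unB_domr yx).
have x0 : N x != 0 by rewrite gt_eqF // (le_lt_trans (un_ge0 NP u)).
by rewrite [N x * _]mulrC -mulf_div divff // mulr1.
Qed.

Lemma rho_beyond y x u u' : N y < N u' -> N u' < N x -> N x <= N u ->
  rho y x u u' <= N u' / N x.
Proof.
move=> yu ux xu; have yx := lt_trans yu ux; have u'u := lt_le_trans ux xu.
rewrite /rho (unB_domr yu) (unB_domr yx) (unB_doml u'u).
have x0 : 0 < N x by rewrite (le_lt_trans (un_ge0 NP u')).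
have u0 : 0 < N u by rewrite (lt_le_trans x0).
have -> : N (x - u) * N u' / (N u * N x) = (N u' / N x) * (N (x - u) / N u).
  by field; rewrite !gt_eqF.
rewrite ler_piMr ?divr_ge0 ?(un_ge0 NP) //.
by rewrite ler_pdivrMr // mul1r unB_le.
Qed.

(** In axis coordinates, a pair violating the bound [c] along (0, oo) also violates it along (y, x),
    provided [u'] lies well inside the annulus between y and x. The point [u] may lie beyond x;
    [rho_beyond] then makes the cross-ratio small anyway. *)
Lemma rho_lt_transfer (c : R) y x u u' :
  N y < N u' -> N u' < N x -> N u' < c * N x -> N u' / N (u - u') < c ->
  rho y x u u' < c.
Proof.
move=> yu ux ucx uc.
have [xu|xu] := ltP (N u) (N x); first by rewrite rho_between // (lt_trans yu).
rewrite (le_lt_trans (rho_beyond yu ux xu)) // ltr_pdivrMr //.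
exact: le_lt_trans (un_ge0 NP _) ux.
Qed.

(** * Homographies, distances and cross-ratios *)

Section Mobius.
Variables a b c d : K.

Definition mob (z : K) := (a * z + b) / (c * z + d).

Lemma mobB z z' : c * z + d != 0 -> c * z' + d != 0 ->
  mob z - mob z' = (a * d - b * c) * (z - z') / ((c * z + d) * (c * z' + d)).
Proof. by move=> ? ?; rewrite /mob; field; apply/andP. Qed.

Lemma mobB_norm z z' : N (a * d - b * c) = 1 -> c * z + d != 0 -> c * z' + d != 0 ->
  N (mob z - mob z') = N (z - z') / (N (c * z + d) * N (c * z' + d)).
Proof. by move=> D1 ? ?; rewrite mobB // un_div !(unM NP) D1 mul1r. Qed.

Lemma mob_pole z : c != 0 -> c * z + d = c * (z - - d / c).
Proof. by move=> c0; field. Qed.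

Lemma mob_pole_neq0 z : c != 0 -> z != - d / c -> c * z + d != 0.
Proof. by move=> c0 zc; rewrite mob_pole // mulf_neq0 // subr_eq0. Qed.

Lemma mob_neq z z' : N (a * d - b * c) = 1 -> c * z + d != 0 -> c * z' + d != 0 ->
  z != z' -> mob z != mob z'.
Proof.
move=> D1 dz dz' zz; rewrite -subr_eq0; apply/eqP => m0.
have := mobB_norm D1 dz dz'; rewrite m0 (un0 NP) => /esym /eqP; apply/negP.
by rewrite mulf_neq0 ?invr_eq0 ?mulf_neq0 // gt_eqF // ?un_sub_eq0 // un_gt0.
Qed.

(** The pole -d/c is the preimage of infinity, so this is invariance of the cross-ratio for the line
    (oo, mob x) pulled back to (-d/c, x). *)
Lemma rho_oo_mob x z z' : N (a * d - b * c) = 1 -> c != 0 ->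
  x != - d / c -> z != - d / c -> z' != - d / c ->
  rho_oo (mob x) (mob z) (mob z') = rho (- d / c) x z z'.
Proof.
move=> D1 c0 xy zy zy'; rewrite /rho_oo !mobB_norm ?mob_pole_neq0 //.
rewrite !(mob_pole _ c0) !(unM NP) /rho (unBC (- d / c) z') (unBC (- d / c) x).
have := (un_gt0 c0, un_sub_eq0 xy, un_sub_eq0 zy, un_sub_eq0 zy').
move=> [[[? ?] ?] ?].
have [->|zz] := eqVneq z z'; first by rewrite subrr (un0 NP) !(mul0r, invr0, mulr0).
by have ? := un_sub_eq0 zz; field; rewrite !gt_eqF.
Qed.

(** The factor 1/|c|^2 is what makes the images of pairs of bounded position short. *)
Lemma mob_dist z z' : N (a * d - b * c) = 1 -> c != 0 ->
  z != - d / c -> z' != - d / c ->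
  N (mob z - mob z') =
    N (z - z') / (N (z - - d / c) * N (z' - - d / c)) / N c ^+ 2.
Proof.
move=> D1 c0 zy zy'; rewrite !mobB_norm ?mob_pole_neq0 //.
rewrite !(mob_pole _ c0) !(unM NP).
have := (un_gt0 c0, un_sub_eq0 zy, un_sub_eq0 zy').
by move=> [[? ?] ?]; field; rewrite !gt_eqF.
Qed.

End Mobius.

Lemma axis_dist e w y b b' : e != w -> y != w -> b != w -> b' != w -> b != y -> b' != y ->
  let u := axis_coord e w in
  N (b - b') / (N (b - y) * N (b' - y)) =
  N (u b - u b') / (N (u b - u y) * N (u b' - u y)) * N (e - w) / N (y - w) ^+ 2.
Proof.
move=> ew yw bw bw' byy by' u; rewrite /u !axis_coordB_norm //.
have := (un_sub_eq0 ew, un_sub_eq0 bw, un_sub_eq0 bw', un_sub_eq0 yw,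
  un_sub_eq0 byy, un_sub_eq0 by').
by move=> [[[[[? ?] ?] ?] ?] ?]; field; rewrite !gt_eqF.
Qed.

End Ultrametric.

(** * Comparison with the axis of a hyperbolic homography *)

Lemma expr_unbounded (R : realType) (L t : R) : 1 < L ->
  exists k0 : nat, forall k, (k0 <= k)%N -> t < L ^+ k.
Proof.
move=> L1; pose s := Num.max 0 (t / (L - 1)).
have s0 : 0 <= s by rewrite le_max lexx.
have L0 : 0 < L - 1 by rewrite subr_gt0.
exists (Num.bound s) => k k0.
have bern : forall i : nat, 1 + i%:R * (L - 1) <= L ^+ i.
  elim=> [|i IH]; first by rewrite mul0r addr0 expr0.
  rewrite exprS; apply: (@le_trans _ _ (L * (1 + i%:R * (L - 1)))); last first.
    by rewrite ler_pM2l // (lt_trans _ L1).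
  rewrite -subr_ge0 -natr1 (_ : _ - _ = i%:R * (L - 1) ^+ 2); last by ring.
  by rewrite mulr_ge0 // sqr_ge0.
have sk : s < k%:R by apply: (lt_le_trans (archi_boundP s0)); rewrite ler_nat.
have : t / (L - 1) < k%:R by apply: le_lt_trans sk; rewrite le_max lexx orbT.
rewrite ltr_pdivrMr // => tk; apply: (lt_le_trans tk); apply: le_trans (bern k).
by rewrite lerDr.
Qed.

Section Shadowing.
Variables (R : realType) (K : fieldType) (N : K -> R).
Hypothesis NP : ultrametric_norm N.
Variables a b c d w : K.
Hypotheses (detN : N (a * d - b * c) = 1) (ba : N b < N a) (ca : N c < N a)
  (da : N d < N a) (c1 : 1 <= N c) (w1 : 1 < N w)
  (wE : c * w ^+ 2 + (d - a) * w - b = 0).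

Local Notation h := (mob a b c d).
Local Notation e := ((a - d) / c - w).
Local Notation u := (axis_coord e w).
Local Notation Lam := (N a ^+ 2).
(** [wE] says that [h] fixes w, and e is the other root by Vieta. The numbers c w + d and c e + d
    are the eigenvalues of the matrix of [h], so [lam] is its multiplier in the coordinate [u]; its
    norm is |a|^2 because the determinant has norm 1. *)
Let lam := (c * w + d) / (c * e + d).

Let bE : b = c * w ^+ 2 + (d - a) * w.
Proof. by apply/esym/eqP; rewrite -subr_eq0 wE. Qed.

Let c0 : c != 0.
Proof. by apply/eqP => c0; move: c1; rewrite c0 (un0 NP); lra. Qed.

Let w0 : w != 0.
Proof. by apply/eqP => w0; move: w1; rewrite w0 (un0 NP); lra. Qed.

Let a1 : 1 < N a. Proof. exact: le_lt_trans ca. Qed.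

Let Lam1 : 1 < Lam.
Proof. by rewrite expr2; have := a1; nra. Qed.

(** The fixed point equation reads c w = a - (d - b/w), where a dominates since |w| > 1. *)
Lemma axis_cw_norm : N (c * w) = N a.
Proof.
have -> : c * w = a - (d - b / w).
  by rewrite bE; field.
apply: (unB_doml NP); apply: (unB_lt NP) => //.
rewrite (un_div NP) ltr_pdivrMr ?(lt_trans _ w1) //.
by rewrite (lt_le_trans ba) // ler_peMr ?(un_ge0 NP) // ltW.
Qed.

Lemma axis_den_norm : N (c * w + d) = N a.
Proof. by rewrite (unD_dom NP) axis_cw_norm. Qed.

Let den_w : c * w + d != 0.
Proof.
by apply/eqP => D0; have := axis_den_norm; rewrite D0 (un0 NP); have := a1; lra.
Qed.

Let vieta : c * w * e = - b.
Proof.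
by rewrite bE; field.
Qed.

Lemma axis_e_lt1 : N e < 1.
Proof.
have : N (c * w * e) = N b by rewrite vieta (unN NP).
rewrite (unM NP) axis_cw_norm => aeb.
by have := a1; have := ba; rewrite -aeb; nra.
Qed.

Let den_we : (c * w + d) * (c * e + d) = a * d - b * c.
Proof.
have -> : (c * w + d) * (c * e + d) = c * (c * w * e) + d * (c * w + c * e + d).
  by field.
by rewrite vieta; field.
Qed.

Let den_e : c * e + d != 0.
Proof.
apply/eqP => e0; have := detN; rewrite -den_we e0 mulr0 (un0 NP).
by move/eqP; rewrite eq_sym oner_eq0.
Qed.

Lemma axis_ew_norm : N (e - w) = N w.
Proof. by apply: (unB_domr NP); apply: lt_trans w1; exact: axis_e_lt1. Qed.

Let e_neq_w : e != w.
Proof.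
by apply/eqP => ew; have := axis_ew_norm; rewrite ew subrr (un0 NP); have := w1; lra.
Qed.

Let hw : h w = w.
Proof.
by apply: (mulIf den_w); rewrite /mob divfK // bE; ring.
Qed.

Let he : h e = e.
Proof.
by apply: (mulIf den_e); rewrite /mob divfK // bE; field.
Qed.

Let lamN : N lam = Lam.
Proof.
have dw := axis_den_norm.
have : N (c * w + d) * N (c * e + d) = 1 by rewrite -(unM NP) den_we.
rewrite /lam (un_div NP) dw => ae.
have e0 := un_gt0 NP den_e.
apply: (mulIf (lt0r_neq0 e0)); rewrite divfK ?lt0r_neq0 //.
by rewrite expr2 -mulrA ae mulr1.
Qed.

Let lamM z : N (lam * z) = Lam * N z.
Proof. by rewrite (unM NP) lamN. Qed.

(** Both h z - h e and h z - h w are computed by [mobB]; in the quotient everything but the two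
    eigenvalues cancels. *)
Lemma axis_coord_mob z : c * z + d != 0 -> z != w -> u (h z) = lam * u z.
Proof.
move=> dz zw; rewrite /axis_coord.
have zw0 : z - w != 0 by rewrite subr_eq0.
have D0 : a * d - b * c != 0.
  by apply/eqP => D0; have := detN; rewrite D0 (un0 NP); lra.
have -> : h z - w = h z - h w by rewrite hw.
have -> : h z - e = h z - h e by rewrite he.
rewrite !mobB // /lam; move: den_e den_w D0; set e1 := e => *.
by field; rewrite ?mulf_neq0 //; do !(apply/andP; split).
Qed.

(** Outside the unit ball distances to w are measured in 1/z, the coordinate in which x and xs are
    assumed close. *)
Lemma axis_coord_out z : 1 < N z -> z != w ->
  N (u z) = (N w * N (z^-1 - w^-1))^-1.
Proof.
move=> z1 zw; have z0 : z != 0.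
  by apply/eqP => z0; move: z1; rewrite z0 (un0 NP); lra.
rewrite (un_div NP) (unB_doml NP) ?(lt_trans axis_e_lt1) //.
have -> : z - w = - (z * w * (z^-1 - w^-1)) by field; apply/andP.
have n0 : z^-1 - w^-1 != 0 by rewrite subr_eq0 (inj_eq invr_inj).
rewrite (unN NP) !(unM NP).
have [[? ?] ?] := (un_gt0 NP z0, un_gt0 NP w0, un_gt0 NP n0).
by field; rewrite !gt_eqF.
Qed.

Lemma axis_coord_in z : N z < 1 -> N (u z) = N (z - e) / N w.
Proof.
move=> z1; rewrite (un_div NP) [N (z - w)](unB_domr NP) //.
exact: lt_trans w1.
Qed.

Lemma axis_coord_far z : z != w -> 1 < N (u z) -> N (z - w) = N w / N (u z).
Proof.
move=> zw uz1; have zw0 := un_sub_eq0 NP zw.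
have : u z - 1 = (w - e) / (z - w).
  by rewrite /axis_coord; field; rewrite ?subr_eq0 ?zw ?c0.
have u1 : N (u z - 1) = N (u z) by rewrite (unB_doml NP) ?(un1 NP).
move/(congr1 N); rewrite u1 => ->.
rewrite (un_div NP) (unBC NP w) axis_ew_norm invf_div mulrCA divff ?mulr1 //.
by have := w1; case: eqP => // ->; lra.
Qed.

(** Here [g] plays the role of G_n, with pole y = y_n, while x = x_n, xs = x_m, ys = y_m; [h]
    carries the line (ys, xs) to (y, x), and the two lines are [del]-close. *)
Variables g1 g2 g3 g4 x xs ys : K.
Variable del : R.
Local Notation y := (- g4 / g3).
Local Notation g := (mob g1 g2 g3 g4).
Hypotheses (gN : N (g1 * g4 - g2 * g3) = 1) (g30 : g3 != 0)
  (y1 : N y < 1) (x1 : 1 < N x) (xs1 : 1 < N xs) (ys1 : N ys < 1)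
  (hxs : h xs = x) (hys : h ys = y)
  (dxs : c * xs + d != 0) (dys : c * ys + d != 0)
  (dx : N (x^-1 - xs^-1) <= del) (dy : N (y - ys) <= del)
  (del0 : 0 < del) (del1 : del < 1) (xw : x != w).

Let y_neq_w : y != w.
Proof. by apply/eqP => yw; have := y1; rewrite yw; have := w1; lra. Qed.

Let ys_neq_w : ys != w.
Proof. by apply/eqP => yw; have := ys1; rewrite yw; have := w1; lra. Qed.

Let x_neq_y : x != y.
Proof. by apply/eqP => yx; have := y1; rewrite -yx; have := x1; lra. Qed.

Let xs_neq_w : xs != w.
Proof. by apply: contra xw => /eqP xsw; rewrite -hxs xsw hw. Qed.

(** Since h xs = x, the distance from 1/xs to 1/w is Lam times that from 1/x to 1/w. If it exceeded
    del, the isosceles principle would make the two distances equal, contradicting Lam > 1. *)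
Lemma shadow_x : N (x^-1 - w^-1) <= del / Lam.
Proof.
have xw0 : 0 < N (x^-1 - w^-1) by rewrite (un_sub_eq0 NP) // (inj_eq invr_inj).
have xsw0 : 0 < N (xs^-1 - w^-1) by rewrite (un_sub_eq0 NP) // (inj_eq invr_inj).
have L0 : 0 < Lam by rewrite (lt_trans _ Lam1).
have wn0 : 0 < N w by rewrite (lt_trans _ w1).
have E : N (xs^-1 - w^-1) = Lam * N (x^-1 - w^-1).
  have := congr1 N (axis_coord_mob dxs xs_neq_w).
  rewrite hxs (unM NP) lamN !axis_coord_out // => E.
  move: E xw0 xsw0 wn0; move: (N w) (N (x^-1 - _)) (N (xs^-1 - _)) => W t s E t0 s0 W0.
  have -> : s = (W * s) * (W * t)^-1 * t by field; rewrite !gt_eqF.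
  by rewrite E; field; rewrite !gt_eqF.
rewrite ler_pdivlMr ?(lt_trans _ Lam1) // mulrC -E leNgt; apply/negP => dlt.
have : N (x^-1 - w^-1) = N (xs^-1 - w^-1).
  have -> : x^-1 - w^-1 = (xs^-1 - w^-1) + (x^-1 - xs^-1) by ring.
  by apply: (unD_dom NP); exact: le_lt_trans dlt.
by move: E xw0 Lam1; move: (N (x^-1 - _)) => t -> t0 L1 E; nra.
Qed.

Lemma shadow_X : Lam / (del * N w) <= N (u x).
Proof.
have xw0 : 0 < N (x^-1 - w^-1) by rewrite (un_sub_eq0 NP) // (inj_eq invr_inj).
have wn0 : 0 < N w by rewrite (lt_trans _ w1).
have L0 : 0 < Lam by rewrite (lt_trans _ Lam1).
rewrite axis_coord_out // -[Lam]invrK -invfM lef_pV2 ?posrE ?mulr_gt0 ?invr_gt0 //.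
have -> : Lam^-1 * (del * N w) = N w * (del / Lam) by rewrite mulrCA mulrA mulrC [del * _]mulrC.
by rewrite ler_pM2l // shadow_x.
Qed.

(** Dual to [shadow_x]: [h] expands around e, so y is Lam times farther from e than ys. *)
Lemma shadow_y : N (y - e) <= del.
Proof.
have := congr1 N (axis_coord_mob dys ys_neq_w).
rewrite hys (unM NP) lamN !axis_coord_in // mulrA.
have wn0 : (N w)^-1 != 0 by rewrite invr_eq0 gt_eqF // (lt_trans _ w1).
move/(mulIf wn0) => E; rewrite leNgt; apply/negP => dlt.
have : N (ys - e) = N (y - e).
  have -> : ys - e = (y - e) - (y - ys) by ring.
  by apply: (unB_doml NP); exact: le_lt_trans dlt.
move=> E'; rewrite E' in E; move: E dlt; move: (N (y - e)) => t E dlt.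
by have := Lam1; have := del0; nra.
Qed.

Lemma shadow_Y : N (u y) <= del / N w.
Proof.
by rewrite axis_coord_in // ler_pM2r ?shadow_y // invr_gt0 (lt_trans _ w1).
Qed.

(** The condition 1 <= |w| |u z'| < Lam describes a fundamental domain of [h], lying strictly above
    u y and below del times u x, so that [rho_lt_transfer] applies. The bound on the distance of the
    images is needed because f only controls short pairs. *)
Lemma shadow_lower (k : R) z z' : z != w -> z' != w -> z != z' -> z != y -> z' != y ->
  del <= k -> N (u z') <= N (u z) -> 1 <= N w * N (u z') < Lam ->
  N (u z') / N (u z - u z') < k ->
  rho_oo N (g x) (g z) (g z') < k /\ N (g z - g z') <= (N g3 ^+ 2)^-1.
Proof.
move=> zw zw' zz zy zy' dk uu /andP[lo hi] uk.
have wn0 : 0 < N w by rewrite (lt_trans _ w1).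
have X := shadow_X; have Y := shadow_Y.
have Yu : N (u y) < N (u z').
  apply: (le_lt_trans Y); rewrite ltr_pdivrMr //; rewrite mulrC in lo.
  exact: lt_le_trans lo.
have uX' : N (u z') < del * N (u x).
  move: X; rewrite ler_pdivrMr ?mulr_gt0 // => X.
  rewrite -(ltr_pM2l wn0); apply: (lt_le_trans hi).
  apply: (le_trans X).
  by have -> : N (u x) * (del * N w) = N w * (del * N (u x)) by ring.
have X0 := un_ge0 NP (u x).
have uX : N (u z') < N (u x) by apply: (lt_le_trans uX'); rewrite ler_piMl // ltW.
split.
  rewrite (rho_oo_mob NP) // (rho_coord NP (e := e) (w := w)) //.
  by apply: (rho_lt_transfer NP) => //; apply: (lt_le_trans uX'); rewrite ler_wpM2r.
(* What remains factors as |u z - u z'| / |u z| times 1 / (|w| |u z'|). The first factor is at most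
   1 since z' has the smaller coordinate, the second by the lower end of the domain. *)
rewrite (mob_dist NP) // -[X in _ <= X]mul1r ler_pM2r; last first.
  by rewrite invr_gt0 exprn_gt0 // (un_gt0 NP).
rewrite (axis_dist NP (e := e) (w := w)) // axis_ew_norm.
have Yu' := lt_le_trans Yu uu.
rewrite [N (y - w)](unB_domr NP) ?(lt_trans y1) //.
rewrite (unB_doml NP Yu) (unB_doml NP Yu').
have u'0 : 0 < N (u z') by exact: le_lt_trans (un_ge0 NP _) Yu.
have u0 : 0 < N (u z) by exact: lt_le_trans uu.
have d_le : N (u z - u z') <= N (u z) by apply: (unB_le NP).
have -> : N (u z - u z') / (N (u z) * N (u z')) * N w / N w ^+ 2
   = (N (u z - u z') / N (u z)) * (N w * N (u z'))^-1.
  by field; rewrite !gt_eqF.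
apply: mulr_ile1; rewrite ?divr_ge0 ?invr_ge0 ?mulr_ge0 ?(un_ge0 NP) //.
  by rewrite ler_pdivrMr // mul1r.
by rewrite invf_le1 ?mulr_gt0.
Qed.

Let x0 : x != 0.
Proof. by apply/eqP => x0; move: x1; rewrite x0 (un0 NP); lra. Qed.

Let xw_norm : N (x - w) = N x * N w * N (x^-1 - w^-1).
Proof.
rewrite -!(unM NP) -(unN NP); congr N; field; exact/andP.
Qed.

(** The pair (w, e) has cross-ratio |1/x - 1/w| |y - e| with the line (y, x), a product of a factor
    below 1 and one at most del. *)
Lemma shadow_axis (k : R) : e != y -> del <= k ->
  rho_oo N (g x) (g w) (g e) < k /\ N (g x - g w) <= (N g3 ^+ 2)^-1.
Proof.
move=> ey dk; have wy : w != y by rewrite eq_sym.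
have wn0 : 0 < N w by rewrite (lt_trans _ w1).
have xn0 : 0 < N x by rewrite (lt_trans _ x1).
have L0 : 0 < Lam by rewrite (lt_trans _ Lam1).
have t1 := shadow_x; have t0 := un_ge0 NP (x^-1 - w^-1).
have t2 : N (x^-1 - w^-1) < 1.
  apply: (le_lt_trans t1); rewrite ltr_pdivrMr // mul1r.
  exact: lt_trans del1 Lam1.
split.
  rewrite (rho_oo_mob NP) // /rho xw_norm (unBC NP w) axis_ew_norm.
  rewrite [N (y - x)](unB_domr NP) ?(lt_trans y1) //.
  have -> : N x * N w * N (x^-1 - w^-1) * N (y - e) / (N w * N x)
    = N (x^-1 - w^-1) * N (y - e) by field; rewrite !gt_eqF.
  have := un_ge0 NP (y - e); have := shadow_y; move: t2 t0 dk del0.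
  by move: (N (y - e)) (N (x^-1 - _)) => s t *; nra.
rewrite (mob_dist NP) // xw_norm.
rewrite (unB_doml NP (x := x)) ?(lt_trans y1) // (unB_doml NP (x := w)) ?(lt_trans y1) //.
rewrite [N x * N w * _]mulrC mulfK ?mulf_neq0 ?gt_eqF //.
rewrite -[X in _ <= X]mul1r ler_pM2r ?ltW //.
by rewrite invr_gt0 exprn_gt0 // (un_gt0 NP).
Qed.

Lemma shadow_norm : N x = N w.
Proof.
have wn0 : 0 < N w by rewrite (lt_trans _ w1).
have L0 : 0 < Lam by rewrite (lt_trans _ Lam1).
have acw : N a = N c * N w by rewrite -(unM NP) axis_cw_norm.
apply: invr_inj; rewrite -!(unV NP).
have -> : x^-1 = w^-1 + (x^-1 - w^-1) by ring.
apply: (unD_dom NP); apply: (le_lt_trans shadow_x).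
rewrite (unV NP) ltr_pdivrMr // ltr_pdivlMl // expr2.
have := a1; have := del1; have := c1; have := w1; have := del0.
by rewrite acw; nra.
Qed.

(** The last hypothesis puts z farther from x than w is, as |x - w| = |x|^2 |1/x - 1/w| <= |x|^2 del
    / Lam. Hence u z stays below u x, and u z' above u y, so [rho_between] gives an equality. *)
Lemma shadow_upper z z' : z != w -> z' != w -> z != z' -> z != x ->
  N (z - x) < N x -> N (z' - x) < N x -> N x ^+ 2 < Lam * N (z - x) ->
  [/\ 0 < N (u z), 0 < N (u z')
    & rho N y x z z' = N (u z') / N (u z - u z')].
Proof.
move=> zw zw' zz zx zxs zxs' zL.
have wn0 : 0 < N w by rewrite (lt_trans _ w1).
have L0 : 0 < Lam by rewrite (lt_trans _ Lam1).
have nz : N z = N x.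
  by have -> : z = x + (z - x) by [ring]; exact: (unD_dom NP).
have nz' : N z' = N x.
  by have -> : z' = x + (z' - x) by [ring]; exact: (unD_dom NP).
have e1 := axis_e_lt1.
have ex t : N t = N x -> N (t - e) = N x.
  by move=> tx; rewrite (unB_doml NP) tx // (lt_trans e1).
have xn0 : 0 < N x by rewrite (lt_trans _ x1).
have zw0 := un_sub_eq0 NP zw; have zw0' := un_sub_eq0 NP zw'.
have xw0 := un_sub_eq0 NP xw.
have uz0 : 0 < N (u z) by rewrite (un_div NP) ex // divr_gt0.
have uz1 : 1 <= N (u z').
  rewrite (un_div NP) ex // ler_pdivlMr // mul1r.
  by apply: (unB_le NP); rewrite ?nz' ?shadow_norm.
have zx0 := un_sub_eq0 NP zx.
have xwz : N (x - w) < N (z - x).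
  rewrite xw_norm -shadow_norm -expr2.
  have := shadow_x; rewrite ler_pdivlMr // => t1.
  rewrite -(ltr_pM2l L0); apply: le_lt_trans zL.
  rewrite mulrCA ler_piMr ?exprn_ge0 ?(un_ge0 NP) // mulrC.
  by rewrite (le_trans t1) // ltW.
have zwE : N (z - w) = N (z - x).
  by have -> : z - w = (z - x) + (x - w) by [ring]; exact: (unD_dom NP).
have uzX : N (u z) < N (u x).
  by rewrite !(un_div NP) !ex // zwE ltr_pM2l // ltf_pV2.
have Y1 : N (u y) < 1.
  apply: (le_lt_trans shadow_Y); rewrite ltr_pdivrMr // mul1r.
  exact: lt_trans del1 w1.
have yx : N (u y) < N (u x).
  apply: (lt_le_trans Y1); rewrite (un_div NP) ex // ler_pdivlMr // mul1r.
  by apply: (unB_le NP); rewrite ?shadow_norm.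
split => //; first exact: lt_le_trans uz1.
rewrite (rho_coord NP (e := e) (w := w)) // (rho_between NP) //.
exact: lt_le_trans uz1.
Qed.

(** [Pair] abstracts the conjugate pairs of the orbit, and g x plays the role of f. [Hf] is the
    lower bound along f; [LF] is local finiteness in the form that a pair with a point very near f
    is short. *)
Variables (Pair : K -> K -> Prop) (kap eps0 : R).
Hypotheses (Psym : forall z z', Pair z z' -> Pair z' z)
  (Pneq : forall z z', Pair z z' -> z != z')
  (Pg : forall z z', Pair z z' -> z != y /\ Pair (g z) (g z'))
  (Ph : forall z z', Pair z z' -> c * z + d != 0 /\ Pair (h z) (h z'))
  (Phinv : forall z z', Pair z z' -> exists t t',
     [/\ Pair t t', h t = z & h t' = z'])
  (Pw : forall z, Pair w z -> z = e)
  (delk : del <= kap)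
  (gsmall : (N g3 ^+ 2)^-1 < eps0)
  (Hf : forall z z', Pair z z' -> N (z - z') < eps0 -> kap <= rho_oo N (g x) z z')
  (LF : forall z z', Pair z z' -> N (g x - z) <= (N g3 ^+ 2)^-1 -> N (z - z') < eps0).

(** Otherwise (w, e) would be a pair. By [LF] its image under g is short, hence subject to [Hf],
    against [shadow_axis]. *)
Lemma shadow_notin z : ~ Pair w z.
Proof.
move=> wz; have ze := Pw wz; rewrite {}ze in wz.
have [wy Pgw] := Pg wz; have [ey _] := Pg (Psym wz).
have [r1 r2] := shadow_axis ey delk.
by have := Hf Pgw (LF Pgw r2); rewrite leNgt r1.
Qed.

Let Pw1 z z' : Pair z z' -> z != w.
Proof. by move=> zz; apply/eqP => zw; apply: (@shadow_notin z'); rewrite -zw. Qed.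

Let Pw2 z z' : Pair z z' -> z' != w.
Proof. by move=> /Psym /Pw1. Qed.

(** Applying the inverse of [h] divides both coordinates by [lam] and preserves the ratio; k steps
    suffice to reach the fundamental domain of [shadow_lower]. *)
Lemma shadow_descent (k : nat) z z' : Pair z z' -> N (u z') <= N (u z) ->
  1 <= N w * N (u z') < Lam ^+ k.+1 -> kap <= N (u z') / N (u z - u z').
Proof.
have L0 : 0 < Lam by rewrite (lt_trans _ Lam1).
elim: k z z' => [|k IH] z z' Pz uu.
  rewrite expr1 => zL; rewrite leNgt; apply/negP => zk.
  have [zy Pgz] := Pg Pz; have [zy' _] := Pg (Psym Pz).
  have [r1 r2] := shadow_lower (Pw1 Pz) (Pw2 Pz) (Pneq Pz) zy zy' delk uu zL zk.
  by have := Hf Pgz (le_lt_trans r2 gsmall); rewrite leNgt r1.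
move=> /andP[lo hi].
have [zs|zs] := ltP (N w * N (u z')) (Lam ^+ k.+1); first by apply: IH => //; rewrite lo.
have [t [t' [Pt tz tz']]] := Phinv Pz.
have [dt _] := Ph Pt; have [dt' _] := Ph (Psym Pt).
have utz : u z = lam * u t by rewrite -tz axis_coord_mob ?(Pw1 Pt).
have utz' : u z' = lam * u t' by rewrite -tz' axis_coord_mob ?(Pw2 Pt).
move: uu lo hi zs; rewrite {}utz {}utz' -mulrBr !lamM => uu lo hi zs.
rewrite -mulf_div divff ?gt_eqF // mul1r; apply: IH => //; first by rewrite -(ler_pM2l L0).
rewrite mulrCA in zs hi.
apply/andP; split; last by rewrite -(ltr_pM2l L0) -exprS.
rewrite -(ler_pM2l L0) mulr1 (le_trans _ zs) // [Lam ^+ k.+1]exprS ler_peMr ?(ltW L0) //.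
by rewrite exprn_ege1 // ltW // Lam1.
Qed.

Lemma shadow_liminf_ge : exists2 eps, 0 < eps &
  forall z z', Pair z z' -> N (z - z') < eps -> kap <= rho_oo N w z z'.
Proof.
have L0 : 0 < Lam by rewrite (lt_trans _ Lam1).
have wn0 : 0 < N w by rewrite (lt_trans _ w1).
(* A pair shorter than this that violates the bound has both points within distance 1 of w, hence in
   the range of [shadow_descent], and e can be exchanged with infinity. *)
exists (Num.max kap 1)^-1; first by rewrite invr_gt0 lt_max ltr01 orbT.
move=> z z' Pz zeps; rewrite leNgt; apply/negP => rk.
have zz0 := un_sub_eq0 NP (Pneq Pz).
have m0 : 0 < Num.max kap 1 by rewrite lt_max ltr01 orbT.
have zz1 : Num.max kap 1 * N (z - z') < 1 by rewrite -ltr_pdivlMl // mulr1.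
have wz1 : N (z - w) < 1.
  rewrite (unBC NP); move: rk; rewrite /rho_oo ltr_pdivrMr // => /lt_trans; apply.
  by apply: le_lt_trans zz1; rewrite ler_pM2r // le_max lexx.
have wz1' : N (z' - w) < 1.
  have -> : z' - w = (z - w) - (z - z') by ring.
  apply: (unB_lt NP) => //; apply: le_lt_trans zz1.
  by rewrite ler_peMl ?(un_ge0 NP) // le_max lexx orbT.
have ub t : t != w -> N (t - w) < 1 -> 1 <= N w * N (u t).
  move=> tw tw1; have tw0 := un_sub_eq0 NP tw.
  have -> : N (u t) = N w / N (t - w).
    rewrite (un_div NP); congr (_ / _).
    have -> : t - e = (t - w) - (e - w) by ring.
    by rewrite (unB_domr NP) axis_ew_norm // (lt_trans tw1).
  by rewrite mulrA ler_pdivlMr // mul1r; have := w1; nra.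
have rho_eq t t' : Pair t t' -> N (t' - w) < 1 ->
  rho_oo N w t t' = N (u t') / N (u t - u t').
  move=> Pt tw; rewrite -(rho_axis NP) ?(Pw1 Pt) ?(Pw2 Pt) ?(Pneq Pt) //.
  by rewrite (rho_oo_near NP) // axis_ew_norm (lt_trans tw).
have descent t t' : Pair t t' -> N (t' - w) < 1 -> N (u t') <= N (u t) ->
  kap <= N (u t') / N (u t - u t').
  move=> Pt tw uu.
  have [k kL] : exists k : nat, N w * N (u t') < Lam ^+ k.+1.
    have [k kL] := expr_unbounded (N w * N (u t')) Lam1.
    by exists k; apply: kL.
  by apply: (@shadow_descent k) => //; rewrite kL ub // (Pw2 Pt).
move: rk; rewrite rho_eq // ltNge => /negP; apply.
(* In the other case the swapped pair has the same denominator and a numerator no larger. *)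
case/orP: (le_total (N (u z')) (N (u z))) => uu; first exact: descent.
apply: (le_trans (descent _ _ (Psym Pz) wz1 uu)).
by rewrite (unBC NP (u z')) ler_wpM2r // invr_ge0 (un_ge0 NP).
Qed.

(** Iterating [h] pushes the realizing pair towards w, making it as short as desired without
    changing its cross-ratio with (e, w). *)
Lemma shadow_liminf_le z z' : Pair z z' -> z != x -> rho N y x z z' = kap ->
  N (z - x) < N x -> N (z' - x) < N x -> N x ^+ 2 < Lam * N (z - x) ->
  forall eps, 0 < eps -> exists t t',
    [/\ Pair t t', N (t - t') < eps & rho_oo N w t t' = kap].
Proof.
move=> Pz zx rk zx1 zx1' zL eps eps0'.
have L0 : 0 < Lam by rewrite (lt_trans _ Lam1).
have wn0 : 0 < N w by rewrite (lt_trans _ w1).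
have [u0 u0' rE] := shadow_upper (Pw1 Pz) (Pw2 Pz) (Pneq Pz) zx zx1 zx1' zL.
have it (k : nat) : exists t t', [/\ Pair t t', u t = lam ^+ k * u z
    & u t' = lam ^+ k * u z'].
  elim: k => [|k [t [t' [Pt tE tE']]]]; first by exists z, z'; rewrite !mul1r.
  have [dt Pht] := Ph Pt; have [dt' _] := Ph (Psym Pt).
  exists (h t), (h t'); rewrite !axis_coord_mob ?(Pw1 Pt) ?(Pw2 Pt) //.
  by rewrite tE tE' !mulrA -exprS.
(* Once |u t| > M, [axis_coord_far] gives |t - w| = |w| / |u t| < min(eps, 1); the bound 1 allows
   replacing e by infinity. *)
pose M := Num.max 1 (N w / Num.min eps 1).
have M0 : 0 < M by rewrite lt_max ltr01.
have [k [kz kz']] : exists k : nat, M < Lam ^+ k * N (u z) /\ M < Lam ^+ k * N (u z').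
  have [i iL] := expr_unbounded (M / N (u z)) Lam1.
  have [j jL] := expr_unbounded (M / N (u z')) Lam1.
  by exists (maxn i j); rewrite -!ltr_pdivrMr // iL ?jL ?leq_maxl ?leq_maxr.
have [t [t' [Pt tE tE']]] := it k; exists t, t'.
have lk : N (lam ^+ k) = Lam ^+ k.
  elim: (k) => [|i IH]; first by rewrite expr0 (un1 NP).
  by rewrite [lam ^+ _]exprS lamM IH [Lam ^+ i.+1]exprS.
have lkM s : N (lam ^+ k * s) = Lam ^+ k * N s by rewrite (unM NP) lk.
have close s r : Pair s r -> M < N (u s) -> N (s - w) < Num.min eps 1.
  move=> Ps; rewrite gt_max => /andP[s1 s2].
  have m0 : 0 < Num.min eps 1 by rewrite lt_min eps0' ltr01.
  rewrite axis_coord_far ?(Pw1 Ps) // ltr_pdivrMr ?(lt_trans _ s1) //.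
  by rewrite mulrC -ltr_pdivrMr.
have ct : N (t - w) < Num.min eps 1 by apply: (close _ _ Pt); rewrite tE lkM.
have ct' : N (t' - w) < Num.min eps 1.
  by apply: (close _ _ (Psym Pt)); rewrite tE' lkM.
split => //.
  have -> : t - t' = (t - w) - (t' - w) by ring.
  by apply: (lt_le_trans (unB_lt NP ct ct')); rewrite ge_min lexx.
have tw1 : N (t' - w) < 1 by apply: (lt_le_trans ct'); rewrite ge_min lexx orbT.
rewrite -(rho_oo_near NP (e := e)) //; last by rewrite axis_ew_norm (lt_trans tw1).
rewrite (rho_axis NP) ?(Pw1 Pt) ?(Pw2 Pt) ?(Pneq Pt) //.
rewrite tE tE' -mulrBr !lkM -mulf_div divff ?mul1r -?rE //.
by rewrite expf_neq0 // gt_eqF.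
Qed.

(** For norms with values in q^Z this expresses that the lower limit equals k; [calphaP] makes the
    translation. *)
Definition liminf_rho (P : K -> K -> Prop) (k : R) (f : K) :=
  (exists2 eps, 0 < eps &
    forall z z', P z z' -> N (z - z') < eps -> k <= rho_oo N f z z') /\
  (forall eps, 0 < eps -> exists z z',
    [/\ P z z', N (z - z') < eps & rho_oo N f z z' = k]).

Lemma shadowing z z' : Pair z z' -> z != x -> rho N y x z z' = kap ->
  N (z - x) < N x -> N (z' - x) < N x -> N x ^+ 2 < Lam * N (z - x) ->
  (forall t, ~ Pair w t) /\ liminf_rho Pair kap w.
Proof.
move=> Pz zx rk zx1 zx1' zL; split; first exact: shadow_notin.
split; first exact: shadow_liminf_ge.
exact: (shadow_liminf_le Pz zx rk zx1 zx1' zL).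
Qed.

End Shadowing.

(** * Quadratic series and their conjugates *)

Section QuadraticSeries.
Variables (F : finFieldType) (R : realType).
Local Notation LS := (laurent_series F).
Local Notation N := (@lnorm F R).
Local Notation po := (@ls_poly F).
Implicit Types (x y z r s : LS) (M : 'M[{poly F}]_2).

Lemma lnorm_ultrametric : ultrametric_norm N.
Proof.
by split; [exact: lnorm_ge0 | exact: lnorm0 | exact: lnorm_eq0 | exact: lnormM
  | exact: lnormD].
Qed.
Let NP := lnorm_ultrametric.

Definition is_rational x := exists p r : {poly F}, r != 0 /\ x = po p / po r.

Lemma inK_rational x : inK x <-> is_rational x.
Proof.
split=> -[p [r [r0 E]]]; exists p, r; split => //; last first.
  by rewrite -[lmul _ _]/(lcoef (po r * x)) E mulrC divfK // ls_poly_eq0.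
have pr0 : po r != 0 by rewrite ls_poly_eq0.
by apply: (mulIf pr0); rewrite divfK // mulrC; exact: lcoef_inj.
Qed.

Lemma rational_poly p : is_rational (po p).
Proof. by exists p, 1; rewrite oner_eq0 rmorph1 divr1. Qed.

Lemma rationalN x : is_rational x -> is_rational (- x).
Proof. by move=> [p [r [r0 ->]]]; exists (- p), r; rewrite rmorphN mulNr. Qed.

Lemma rationalD x y : is_rational x -> is_rational y -> is_rational (x + y).
Proof.
move=> [p [r [r0 ->]]] [p' [r' [r'0 ->]]]; exists (p * r' + p' * r), (r * r').
rewrite mulf_neq0 // rmorphD !rmorphM addf_div ?ls_poly_eq0 //.
Qed.

Lemma rationalB x y : is_rational x -> is_rational y -> is_rational (x - y).
Proof. by move=> ? /rationalN; exact: rationalD. Qed.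

Lemma rationalM x y : is_rational x -> is_rational y -> is_rational (x * y).
Proof.
move=> [p [r [r0 ->]]] [p' [r' [r'0 ->]]]; exists (p * p'), (r * r').
by rewrite mulf_neq0 // !rmorphM mulf_div.
Qed.

Lemma rationalV x : is_rational x -> is_rational x^-1.
Proof.
move=> [p [r [r0 ->]]]; have [->|p0] := eqVneq p 0.
  by rewrite rmorph0 mul0r invr0 -(rmorph0 po); exact: rational_poly.
by exists r, p; rewrite invf_div.
Qed.

Lemma rational_div x y : is_rational x -> is_rational y -> is_rational (x / y).
Proof. by move=> ? /rationalV; exact: rationalM. Qed.

Lemma irrational_lin0 x r s : ~ is_rational x -> is_rational r -> is_rational s ->
  r * x + s = 0 -> r = 0 /\ s = 0.
Proof.
move=> xK rK sK E; have r0 : r = 0.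
  apply: contrapT => /eqP r0; apply: xK.
  have rx : r * x = - s by apply/eqP; rewrite -addr_eq0 E.
  rewrite (_ : x = - s / r); last by rewrite -rx mulrC mulKf.
  by apply: rational_div => //; exact: rationalN.
by split => //; move: E; rewrite r0 mul0r add0r.
Qed.

(** Galois conjugacy over K through trace and norm, in a form valid in every characteristic and
    visibly symmetric. *)
Definition conjugate x x' :=
  [/\ ~ is_rational x, x != x', is_rational (x + x') & is_rational (x * x')].

Lemma conjugate_sym x x' : conjugate x x' -> conjugate x' x.
Proof.
case=> xK xx xD xM; split; [|by rewrite eq_sym|by rewrite addrC|by rewrite mulrC].
by move=> x'K; apply: xK; rewrite -(addrK x' x); exact: rationalB.
Qed.

Lemma conjugate_annihilator x x' : conjugate x x' -> exists A B C : {poly F},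
  A != 0 /\ forall y, po A * (y * y) + po B * y + po C = po A * (y - x) * (y - x').
Proof.
case=> _ _ [p [r [r0 E]]] [p' [r' [r'0 E']]].
exists (r * r'), (- (p * r')), (p' * r); split; first by rewrite mulf_neq0.
move=> y; rewrite rmorphN !rmorphM /=.
have -> : po p = (x + x') * po r by rewrite E divfK // ls_poly_eq0.
have -> : po p' = (x * x') * po r' by rewrite E' divfK // ls_poly_eq0.
by ring.
Qed.

Lemma conjugate_root x x' (A B C : {poly F}) : conjugate x x' ->
  po A * (x * x) + po B * x + po C = 0 -> po A * (x' * x') + po B * x' + po C = 0.
Proof.
move=> [xK xx xD xM] E.
have [|||E1 E2] := @irrational_lin0 x (po A * (x + x') + po B) (po C - po A * (x * x')) xK.
- by apply: rationalD; [apply: rationalM => //|]; exact: rational_poly.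
- by apply: rationalB; [|apply: rationalM => //]; exact: rational_poly.
- by rewrite -E; ring.
have -> : po A * (x' * x') + po B * x' + po C
  = (po A * (x + x') + po B) * x' + (po C - po A * (x * x')) by ring.
by rewrite E1 E2 mul0r addr0.
Qed.

Lemma conjugate_uniq x x' x'' : conjugate x x' -> conjugate x x'' -> x' = x''.
Proof.
move=> c1 c2; have [A [B [C [A0 AE]]]] := conjugate_annihilator c1.
have : po A * (x'' * x'') + po B * x'' + po C = 0.
  by apply: (conjugate_root c2); rewrite AE subrr mulr0 mul0r.
rewrite AE => /eqP; rewrite !mulf_eq0 ls_poly_eq0 (negbTE A0) /= !subr_eq0.
by case/orP => /eqP // xx; case: c2 => _; rewrite xx eqxx.
Qed.

(** [galconj] chooses a series distinct from x that satisfies every quadratic equation of x; the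
    annihilator of x has only the roots x and x'. *)
Lemma conjugate_galconj x x' : conjugate x x' -> galconj x = x'.
Proof.
move=> cx; have [A [B [C [A0 AE]]]] := conjugate_annihilator cx.
rewrite /galconj; set P := (X in xget _ X).
have Px' : P (lcoef x').
  split; [exact: lcoefP|split].
    by move=> /lcoef_inj xx; case: cx => _; rewrite xx eqxx.
  move=> A' B' C' /(@lcoef_inj _ (po A' * (x * x) + po B' * x + po C') 0) E.
  by have := conjugate_root cx E => /(congr1 (@lcoef F)).
have := @xgetPex _ (lcoef x) P (ex_intro _ _ Px').
move: (xget _ _) => g [gL [gx gP]].
pose y := LaurentSeries gL; rewrite -[g]/(lcoef y); congr lcoef.
have : po A * (y * y) + po B * y + po C = 0.
  apply: lcoef_inj; apply: gP.
  rewrite -[LHS]/(lcoef (po A * (x * x) + po B * x + po C)).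
  by rewrite AE subrr mulr0 mul0r.
rewrite AE => /eqP; rewrite !mulf_eq0 ls_poly_eq0 (negbTE A0) /= !subr_eq0.
by case/orP => /eqP // yx; case: gx; rewrite -yx.
Qed.

(** This rules out inseparable quadratic series. If x^2 = p/r, let s be the fractional part of r x,
    with polynomial part t. In characteristic 2, s^2 = p r - t^2 is a polynomial of norm less than
    1, so s = 0. *)
Lemma rational_sqrt_pchar2 x : (2%:R : LS) = 0 -> is_rational (x * x) -> is_rational x.
Proof.
move=> two0 [p [r [r0 E]]]; have pr0 : po r != 0 by rewrite ls_poly_eq0.
have [t tx] := lnorm_floor R (po r * x); set s := po r * x - po t in tx.
have sE : s * s = po (p * r - t * t).
  have -> : s * s = po r * po r * (x * x) + po t * po t - 2%:R * (po r * x * po t).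
    by rewrite /s; ring.
  rewrite two0 mul0r subr0 E rmorphB !rmorphM /=.
  have tt : po t * po t = - (po t * po t).
    by apply/eqP; rewrite -subr_eq0 opprK -mulr2n -mulr_natl two0 mul0r.
  by rewrite {1}tt; field.
have s0 : s = 0.
  apply/eqP/negPn/negP => s0.
  have : p * r - t * t != 0 by rewrite -ls_poly_eq0 -sE mulf_neq0.
  move/(lnorm_poly_ge1 R); rewrite -sE (unM NP).
  by have := un_ge0 NP s; nra.
exists t, r; split => //; apply: (mulIf pr0); rewrite divfK // mulrC.
by apply/eqP; rewrite -subr_eq0 -/s s0.
Qed.

Lemma quadraticP x : quadratic x <-> exists x', conjugate x x'.
Proof.
split=> [[_ [xK [A [B [C [A0]]]]]]|[x' cx]]; last first.
  split; first exact: lcoefP.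
  split; first by case: cx => xK _ _ _ /inK_rational.
  have [A [B [C [A0 AE]]]] := conjugate_annihilator cx; exists A, B, C; split => //.
  rewrite -[LHS]/(lcoef (po A * (x * x) + po B * x + po C)).
  by rewrite AE subrr mulr0 mul0r.
move=> /(@lcoef_inj _ (po A * (x * x) + po B * x + po C) 0) E.
have {}xK : ~ is_rational x by move=> /inK_rational.
have pA0 : po A != 0 by rewrite ls_poly_eq0.
have BA : is_rational (- po B / po A).
  by apply: rational_div; [apply: rationalN|]; exact: rational_poly.
have CA : is_rational (po C / po A) by apply: rational_div; exact: rational_poly.
have xM : x * (- po B / po A - x) = po C / po A.
  apply/eqP; rewrite -subr_eq0; apply/eqP.
  have -> : x * (- po B / po A - x) - po C / po A
    = - (po A * (x * x) + po B * x + po C) / po A by field.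
  by rewrite E oppr0 mul0r.
exists (- po B / po A - x); split; rewrite ?xM // ?[x + _]addrC ?subrK //.
(* A double root would give 2 x = -B/A: then x is rational, or the characteristic is 2 and x^2 is
   rational. *)
apply/eqP => xE; have x2 : 2%:R * x = - po B / po A.
  by rewrite mulr_natl mulr2n {1}xE subrK.
have [two0|two0] := eqVneq (2%:R : LS) 0.
  by apply: xK; apply: rational_sqrt_pchar2 => //; rewrite {2}xE xM.
apply: xK; rewrite (_ : x = (- po B / po A) / 2%:R); last by rewrite -x2 mulrC mulKf.
by apply: rational_div => //; rewrite -(rmorph_nat po); exact: rational_poly.
Qed.

(** * Homographies with polynomial coefficients *)

Definition mobM M := mob (po (M 0 0)) (po (M 0 1)) (po (M 1 0)) (po (M 1 1)).
Local Notation den M z := (po (M 1 0) * z + po (M 1 1)).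

Lemma mulmx2E (M M' : 'M[{poly F}]_2) i j :
  (M *m M') i j = M i 0 * M' 0 j + M i 1 * M' 1 j.
Proof. by rewrite mxE big_ord_recl big_ord1; congr (_ + M i _ * M' _ j); apply/val_inj. Qed.

Lemma det_mx2E M : \det M = M 0 0 * M 1 1 - M 0 1 * M 1 0.
Proof.
rewrite (expand_det_row _ 0) big_ord_recl big_ord1 /cofactor !det_mx11 !mxE /=.
rewrite expr0 mul1r expr1 mulN1r mulrN.
by congr (_ * M _ _ - M 0 _ * M _ _); apply/val_inj.
Qed.

(** The determinant and its inverse are both nonzero polynomials, hence of norm at least 1. *)
Lemma unitmx_detE M : M \in unitmx ->
  N (po (M 0 0) * po (M 1 1) - po (M 0 1) * po (M 1 0)) = 1.
Proof.
rewrite unitmxE => /unitrP[D [DM _]].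
rewrite -!rmorphM -rmorphB -det_mx2E.
have [M0 D0] : \det M != 0 /\ D != 0.
  by apply/andP; rewrite -negb_or orbC -mulf_eq0 DM oner_eq0.
have := lnorm_poly_ge1 R M0; have := lnorm_poly_ge1 R D0.
have : N (po D) * N (po (\det M)) = 1 by rewrite -(unM NP) -rmorphM DM rmorph1 (un1 NP).
by move: (N _) (N _) => s t st s1 t1; nra.
Qed.

Lemma den_neq0 M z : M \in unitmx -> ~ is_rational z -> den M z != 0.
Proof.
move=> Mu zK; apply/eqP => E.
have [||c0 d0] := irrational_lin0 zK _ _ E; try exact: rational_poly.
have := unitmx_detE Mu; rewrite c0 d0 !mulr0 subrr (un0 NP) => /eqP.
by rewrite eq_sym oner_eq0.
Qed.

Lemma mobM_mul M M' z : den M' z != 0 -> den M (mobM M' z) != 0 ->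
  mobM (M *m M') z = mobM M (mobM M' z).
Proof.
move=> d1 d2.
have rowE i : po ((M *m M') i 0) * z + po ((M *m M') i 1)
  = den M' z * (po (M i 0) * mobM M' z + po (M i 1)).
  by rewrite !mulmx2E !rmorphD !rmorphM /= /mobM /mob; field.
by rewrite {1}/mobM /mob !rowE -mulf_div divff // mul1r.
Qed.

Lemma mobM1 z : mobM 1%:M z = z.
Proof. by rewrite /mobM /mob !mxE /= rmorph0 rmorph1 mul1r mul0r addr0 add0r divr1. Qed.

(** A rational value would give a linear relation on z over K, forcing the rows of M to be
    proportional. *)
Lemma mobM_irrational M z : M \in unitmx -> ~ is_rational z -> ~ is_rational (mobM M z).
Proof.
move=> Mu zK mK; have dz := den_neq0 Mu zK.
have mE : mobM M z * den M z = po (M 0 0) * z + po (M 0 1) by rewrite divfK.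
have [|||aE bE] := @irrational_lin0 z (po (M 0 0) - mobM M z * po (M 1 0))
  (po (M 0 1) - mobM M z * po (M 1 1)) zK.
- by apply: rationalB; [|apply: rationalM => //]; exact: rational_poly.
- by apply: rationalB; [|apply: rationalM => //]; exact: rational_poly.
- rewrite -[RHS](subrr (mobM M z * den M z)) {1}mE; ring.
have := unitmx_detE Mu.
move/eqP: aE; rewrite subr_eq0 => /eqP ->; move/eqP: bE; rewrite subr_eq0 => /eqP ->.
rewrite (_ : _ - _ = 0); last by ring.
by rewrite (un0 NP) => /eqP; rewrite eq_sym oner_eq0.
Qed.

End QuadraticSeries.

(** * Pairs of conjugate points in an orbit *)

Section OrbitPairs.
Variables (F : finFieldType) (R : realType).
Local Notation LS := (laurent_series F).
Local Notation N := (@lnorm F R).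
Local Notation po := (@ls_poly F).
Implicit Types (x y z r s al : LS) (M : 'M[{poly F}]_2).
Let NP := lnorm_ultrametric F R.

Local Ltac rat := repeat first [exact: rational_poly | assumption
  | apply: rationalD | apply: rationalM].

Lemma mobM_mulE M M' z : M \in unitmx -> M' \in unitmx -> ~ is_rational z ->
  mobM (M *m M') z = mobM M (mobM M' z).
Proof.
move=> Mu Mu' zK; apply: mobM_mul; first exact: (den_neq0 R Mu').
by apply: (den_neq0 R Mu); apply: (mobM_irrational R).
Qed.

Lemma mobMVK M z : M \in unitmx -> ~ is_rational z -> mobM M (mobM (invmx M) z) = z.
Proof. by move=> Mu zK; rewrite -mobM_mulE ?unitmx_inv // mulmxV // mobM1. Qed.

Lemma conjugate_mobM M x x' : M \in unitmx -> conjugate x x' ->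
  conjugate (mobM M x) (mobM M x').
Proof.
move=> Mu cx; have [xK xx xD xM] := cx; have [xK' _ _ _] := conjugate_sym cx.
have d1 := den_neq0 R Mu xK; have d2 := den_neq0 R Mu xK'.
split; first exact: (mobM_irrational R).
- exact: (mob_neq NP (unitmx_detE R Mu)).
- have -> : mobM M x + mobM M x' =
    (po (M 0 0) * po (M 1 0) * (x * x') + po (M 0 0) * po (M 1 0) * (x * x')
     + (po (M 0 0) * po (M 1 1) + po (M 0 1) * po (M 1 0)) * (x + x')
     + po (M 0 1) * po (M 1 1) + po (M 0 1) * po (M 1 1)) /
    (po (M 1 0) * po (M 1 0) * (x * x') + po (M 1 0) * po (M 1 1) * (x + x')
     + po (M 1 1) * po (M 1 1)).
    rewrite [X in _ = _ / X](_ : _ = (po (M 1 0) * x + po (M 1 1)) * (po (M 1 0) * x' + po (M 1 1))); last by ring.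
    by rewrite /mobM /mob; field; apply/andP.
  by apply: rational_div; rat.
- have -> : mobM M x * mobM M x' =
    (po (M 0 0) * po (M 0 0) * (x * x') + po (M 0 0) * po (M 0 1) * (x + x')
     + po (M 0 1) * po (M 0 1)) /
    (po (M 1 0) * po (M 1 0) * (x * x') + po (M 1 0) * po (M 1 1) * (x + x')
     + po (M 1 1) * po (M 1 1)).
    rewrite /mobM /mob mulf_div; congr (_ / _); ring.
  by apply: rational_div; rat.
Qed.

Definition orbit_pair al al' z z' := exists2 M, M \in unitmx &
  (z = mobM M al /\ z' = mobM M al') \/ (z = mobM M al' /\ z' = mobM M al).

Lemma orbit_pair_sym al al' z z' : orbit_pair al al' z z' -> orbit_pair al al' z' z.
Proof. by move=> [M Mu [[-> ->]|[-> ->]]]; exists M => //; [right|left]. Qed.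

Lemma orbit_pair_conj al al' z z' : conjugate al al' ->
  orbit_pair al al' z z' -> conjugate z z'.
Proof.
move=> ca [M Mu [[-> ->]|[-> ->]]]; apply: conjugate_mobM => //.
exact: conjugate_sym.
Qed.

Lemma orbit_pair_mobM al al' M z z' : conjugate al al' -> M \in unitmx ->
  orbit_pair al al' z z' -> orbit_pair al al' (mobM M z) (mobM M z').
Proof.
move=> ca Mu [M' Mu' E]; exists (M *m M'); first by rewrite unitmx_mul Mu.
have [aK _ _ _] := ca; have [aK' _ _ _] := conjugate_sym ca.
by rewrite !mobM_mulE //; case: E => -[-> ->]; [left|right].
Qed.

Lemma orbit_pair_inv al al' M z z' : conjugate al al' -> M \in unitmx ->
  orbit_pair al al' z z' ->
  exists t t', [/\ orbit_pair al al' t t', mobM M t = z & mobM M t' = z'].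
Proof.
move=> ca Mu Pz; exists (mobM (invmx M) z), (mobM (invmx M) z').
have cz := orbit_pair_conj ca Pz; have [zK _ _ _] := cz.
have [zK' _ _ _] := conjugate_sym cz.
by rewrite !mobMVK //; split => //; apply: orbit_pair_mobM; rewrite ?unitmx_inv.
Qed.

Lemma ThetaP al al' z : conjugate al al' ->
  Theta al z <-> exists z', orbit_pair al al' z z'.
Proof.
move=> ca; have ga := conjugate_galconj ca.
have [aK _ _ _] := ca; have [aK' _ _ _] := conjugate_sym ca.
have hom M (x : LS) : M \in unitmx -> ~ is_rational x ->
    homography M x z <-> z = mobM M x.
  move=> Mu xK; have d0 := den_neq0 R Mu xK.
  rewrite /homography /=; split => [[_ E]|->].
    apply: (mulfI d0); rewrite [RHS]mulrC divfK //; exact: lcoef_inj.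
  split; first by move=> /(@lcoef_inj _ (po (M 1 0) * x + po (M 1 1)) 0) /eqP; apply/negP.
  rewrite -[lmul _ _]/(lcoef ((po (M 1 0) * x + po (M 1 1)) * mobM M x)).
  by rewrite mulrC divfK.
split=> [[_ [M [Mu [g [gE]]]]]|[z' [M Mu E]]].
  case: gE => ->; rewrite ?ga => /hom -> //.
    by exists (mobM M al'), M => //; left.
  by exists (mobM M al), M => //; right.
split; first exact: lcoefP.
exists M; split => //; case: E => -[zE _].
  by exists al; split; [left | apply/hom].
by exists al'; split; [right | apply/hom].
Qed.

(** * Local finiteness of the set of pairs *)

Lemma finite_lower_bound (T : finType) (phi : T -> R) : (forall t, 0 < phi t) ->
  exists2 eta, 0 < eta & forall t, eta <= phi t.
Proof.
move=> phi0; suff [eta eta0 H] : exists2 eta, 0 < eta &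
    forall t, t \in enum T -> eta <= phi t.
  by exists eta => // t; apply: H; rewrite mem_enum.
elim: (enum T) => [|t s [eta eta0 IH]]; first by exists 1.
exists (Num.min eta (phi t)); first by rewrite lt_min eta0 phi0.
move=> t'; rewrite inE => /orP[/eqP ->|/IH H]; first by rewrite ge_min lexx orbT.
by rewrite ge_min H.
Qed.

(** Over a finite field only finitely many polynomials have bounded norm, hence finitely many values
    occur. *)
Lemma bounded_forms_lower_bound f (T : R) : exists2 eta, 0 < eta &
  forall A B C : {poly F}, N (po A) <= T -> N (po B) <= T -> N (po C) <= T ->
    po A * (f * f) - po B * f + po C != 0 ->
    eta <= N (po A * (f * f) - po B * f + po C).
Proof.
have [n nT] := expr_unbounded T (card_gt1 F R).
have size_le (p : {poly F}) : N (po p) <= T -> (size p <= n)%N.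
  have [->|p0] := eqVneq p 0; first by rewrite size_poly0.
  rewrite lnorm_poly // => pT; rewrite leqNgt; apply/negP => np.
  have : (n <= (size p).-1)%N by rewrite -ltnS prednK // (leq_ltn_trans _ np).
  by move/nT; rewrite ltNge pT.
pose P (v : {ffun 'I_n -> F}) : {poly F} := \poly_(i < n) (if insub i is Some j then v j else 0).
have PE (p : {poly F}) : (size p <= n)%N -> p = P [ffun i : 'I_n => p`_i].
  move=> pn; apply/polyP => i; rewrite coef_poly; case: ltnP => ni.
    by rewrite insubT ffunE.
  by rewrite nth_default // (leq_trans pn).
pose val (t : {ffun 'I_n -> F} * {ffun 'I_n -> F} * {ffun 'I_n -> F}) :=
  po (P t.1.1) * (f * f) - po (P t.1.2) * f + po (P t.2).
have [|eta eta0 H] := @finite_lower_bound _ (fun t => if val t == 0 then 1 else N (val t)).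
  by move=> t; case: eqVneq => // v0; exact: (un_gt0 NP).
exists eta => // A B C /size_le/PE -> /size_le/PE -> /size_le/PE -> v0.
have := H ([ffun i : 'I_n => A`_i], [ffun i : 'I_n => B`_i], [ffun i : 'I_n => C`_i]).
by rewrite /val /= (negbTE v0).
Qed.

(** Every orbit pair is the pair of roots of A X^2 - B X + C with polynomial coefficients, and |A|
    |z - z'|, the norm of a square root of the discriminant, is constant on the orbit. *)
Lemma orbit_pair_form al al' : conjugate al al' -> exists D : R,
  forall z z', orbit_pair al al' z z' -> exists A B C : {poly F},
   [/\ A != 0, po A * (z + z') = po B, po A * (z * z') = po C
     & N (po A) * N (z - z') = D].
Proof.
move=> ca; have [A0 [B0 [C0 [A00 AE]]]] := conjugate_annihilator ca.
have [aK aa _ _] := ca; have [aK' _ _ _] := conjugate_sym ca.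
have C0E : po C0 = po A0 * (al * al').
  by have := AE 0; rewrite !mulr0 !add0r => ->; ring.
have B0E : po B0 = - (po A0 * (al + al')).
  have := AE 1; rewrite C0E !mulr1 => E; apply: (addIr (po A0 * (al * al'))).
  apply: (addrI (po A0)); rewrite addrA E; ring.
exists (N (po A0) * N (al - al')) => z z' [M Mu E].
have d1 := den_neq0 R Mu aK; have d2 := den_neq0 R Mu aK'.
pose a := M 0 0; pose b := M 0 1; pose c := M 1 0; pose d := M 1 1.
(* Up to the sign of the middle coefficient, these come from substituting the adjugate of M into the
   homogenized form of al. *)
exists (C0 * c * c - B0 * c * d + A0 * d * d),
  (C0 * a * c *+ 2 - B0 * (a * d + b * c) + A0 * b * d *+ 2),
  (C0 * a * a - B0 * a * b + A0 * b * b).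
have Q0 : po A0 * ((po c * al + po d) * (po c * al' + po d)) != 0.
  by rewrite !mulf_neq0 ?ls_poly_eq0.
have QE : po (C0 * c * c - B0 * c * d + A0 * d * d)
  = po A0 * ((po c * al + po d) * (po c * al' + po d)).
  by rewrite rmorphD rmorphB !rmorphM /= C0E B0E; ring.
have wlogE : (z + z' = mobM M al + mobM M al') /\ (z * z' = mobM M al * mobM M al')
   /\ N (z - z') = N (mobM M al - mobM M al').
  by case: E => -[-> ->]; split=> //; [rewrite addrC|rewrite mulrC (unBC NP)].
have [-> [-> ->]] := wlogE; split.
- by rewrite -ls_poly_eq0 QE.
- rewrite QE rmorphD rmorphB !rmorphMn !rmorphM rmorphD !rmorphM /= C0E B0E /mobM /mob.
  by field; apply/andP.
- rewrite QE rmorphD rmorphB !rmorphM /= C0E B0E /mobM /mob.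
  by field; apply/andP.
- rewrite QE (mobB_norm NP (unitmx_detE R Mu)) // !(unM NP).
  have [? ?] := (un_gt0 NP d1, un_gt0 NP d2).
  by field; rewrite !gt_eqF.
Qed.

(** A pair of length at least eps has |A| <= D/eps. If moreover z is near f, then B and C are
    bounded too, so the form is one of finitely many. Its value A (f - z) (f - z') at f is nonzero,
    hence bounded below, which keeps z away from f. *)
Lemma orbit_pair_locally_finite al al' f (eps : R) : conjugate al al' ->
  (forall z, ~ orbit_pair al al' f z) -> 0 < eps ->
  exists2 del, 0 < del & forall z z', orbit_pair al al' z z' ->
    N (f - z) < del -> N (z - z') < eps.
Proof.
move=> ca fT eps0; have [D DP] := orbit_pair_form ca.
pose B1 := Num.max (Num.max (N f) 1) D.
have B11 : 1 <= B1 by rewrite !le_max lexx orbT.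
have B1D : D <= B1 by rewrite le_max lexx orbT.
have B1f : N f <= B1 by rewrite !le_max lexx.
pose T := Num.max 1 (D / eps) * (B1 * B1).
have T0 : 0 < T by rewrite !mulr_gt0 ?(lt_le_trans _ B11) // lt_max ltr01.
have [eta eta0 H] := bounded_forms_lower_bound f T.
exists (Num.min 1 (eta / (T * B1))).
  by rewrite lt_min ltr01 divr_gt0 // mulr_gt0 // (lt_le_trans _ B11).
move=> z z' Pz; rewrite lt_min => /andP[fz1 fz2]; rewrite ltNge; apply/negP => zz.
have [A [B [C [A0 BE CE AD]]]] := DP _ _ Pz.
have A1 := lnorm_poly_ge1 R A0.
have A2 : N (po A) <= Num.max 1 (D / eps).
  rewrite le_max ler_pdivlMr // -AD ler_wpM2l ?orbT //; exact: (un_ge0 NP).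
have zzD : N (z - z') <= D by rewrite -AD ler_peMl // (un_ge0 NP).
have zB : N z <= B1.
  have -> : z = f - (f - z) by ring.
  by apply: (unB_le NP) => //; rewrite (le_trans (ltW fz1)).
have zB' : N z' <= B1.
  have -> : z' = z - (z - z') by ring.
  by apply: (unB_le NP) => //; rewrite (le_trans zzD).
have m1 : 1 <= Num.max 1 (D / eps) by rewrite le_max lexx.
have AT : N (po A) <= T.
  by rewrite (le_trans A2) // ler_peMr ?(le_trans _ m1) //; nra.
have BT : N (po B) <= T.
  rewrite -BE (unM NP) ler_pM ?(un_ge0 NP) //.
  rewrite (le_trans (unD NP _ _)) // ge_max.
  by apply/andP; split; [apply: (le_trans zB)|apply: (le_trans zB')]; nra.
have CT : N (po C) <= T.
  by rewrite -CE !(unM NP) ler_pM ?mulr_ge0 ?(un_ge0 NP) // ler_pM ?(un_ge0 NP).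
have vE : po A * (f * f) - po B * f + po C = po A * ((f - z) * (f - z')).
  by rewrite -BE -CE; ring.
have v0 : po A * (f * f) - po B * f + po C != 0.
  rewrite vE !mulf_neq0 ?ls_poly_eq0 // subr_eq0; apply/eqP => fE.
    by apply: (fT z'); rewrite fE.
  by apply: (fT z); rewrite fE; exact: orbit_pair_sym.
have := H _ _ _ AT BT CT v0; rewrite vE !(unM NP) leNgt => /negP; apply.
have fz' : N (f - z') <= B1 by apply: (unB_le NP).
have B10 : 0 < B1 by exact: lt_le_trans B11.
have TB0 : 0 < T * B1 by exact: mulr_gt0.
move: fz2; rewrite ltr_pdivlMr //; apply: le_lt_trans.
rewrite mulrCA ler_wpM2l ?(un_ge0 NP) //.
by rewrite ler_pM ?(un_ge0 NP).
Qed.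

End OrbitPairs.

(** * Continued fractions *)

Section ContinuedFraction.
Variables (F : finFieldType) (R : realType).
Local Notation LS := (laurent_series F).
Local Notation N := (@lnorm F R).
Local Notation po := (@ls_poly F).
Local Notation q := (#|F|%:R : R).
Implicit Types (x y z w : LS) (M : 'M[{poly F}]_2).
Let NP := lnorm_ultrametric F R.

Lemma small_lnorm x : small x <-> N x < 1.
Proof.
have one : (1 : R) = q ^ 0 by [].
rewrite /small -(lnorm_le R); split => [x1|x1].
  by apply: (le_lt_trans x1); rewrite one ltr_eXz2l // card_gt1.
have [->|/(lnorm_ex R)[d xd]] := eqVneq x 0; first by rewrite lnorm0; exact/ltW/exprq_gt0.
move: x1; rewrite xd one ltr_eXz2l ?card_gt1 // => d0.
by rewrite ler_eXz2l ?card_gt1 //; lia.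
Qed.

(** For v = 1/w the equation becomes v = (c - b v^2) / (a - d), a contraction of the open unit ball
    because a dominates; v is nonzero because c is. *)
Lemma hyperbolic_fixpoint (a b c d : LS) : N b < N a -> N c < N a -> N d < N a ->
  c != 0 -> exists2 w, 1 < N w & c * w ^+ 2 + (d - a) * w - b = 0.
Proof.
move=> ba ca da c0.
have adN : N (a - d) = N a by exact: (unB_doml NP).
have aN0 : 0 < N a by exact: le_lt_trans (un_ge0 NP b) ba.
have ad0 : a - d != 0 by apply/eqP => E; move: aN0; rewrite -adN E (un0 NP) ltxx.
have [||v vS vE] := @contraction_fixpoint F (fun v => (c - b * (v * v)) / (a - d)).
- move=> v /small_lnorm v1; apply/small_lnorm.
  rewrite (un_div NP) adN ltr_pdivrMr // mul1r; apply: (unB_lt NP) => //.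
  rewrite !(unM NP); apply: le_lt_trans ba; rewrite ler_piMr ?(un_ge0 NP) //.
  by have := un_ge0 NP v; nra.
- move=> v v' /small_lnorm v1 /small_lnorm v1'.
  exists (- b * (v + v') / (a - d)); last by field.
  apply/small_lnorm; rewrite (un_div NP) adN ltr_pdivrMr // mul1r (unM NP) (unN NP).
  have vv := unD_lt NP v1 v1'; apply: le_lt_trans ba.
  by rewrite ler_piMr ?(un_ge0 NP) // ltW.
have v0 : v != 0.
  apply/eqP => v0; move: vE; rewrite v0 !mulr0 subr0 => /eqP.
  by rewrite mulf_eq0 invr_eq0 (negbTE c0) (negbTE ad0).
exists v^-1.
  rewrite (unV NP) invf_gt1 ?(un_gt0 NP) //; exact/small_lnorm.
have -> : c * v^-1 ^+ 2 + (d - a) * v^-1 - b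
  = ((c - b * (v * v)) / (a - d) - v) * (a - d) / (v * v) by field; apply/andP.
by rewrite vE subrr !mul0r.
Qed.

(* Applying [h^-1] to a fraction [p / r] representing the attracting fixed point [w]
   divides the norm of the denominator by the dominant eigenvalue [c w + d]. *)
Lemma hyperbolic_fixpoint_irrational M w : M \in unitmx ->
  N (po (M 0 1)) < N (po (M 0 0)) -> N (po (M 1 0)) < N (po (M 0 0)) ->
  N (po (M 1 1)) < N (po (M 0 0)) -> M 1 0 != 0 -> 1 < N w ->
  po (M 1 0) * w ^+ 2 + (po (M 1 1) - po (M 0 0)) * w - po (M 0 1) = 0 ->
  ~ is_rational w.
Proof.
move=> Mu ba ca da c0 w1 wE [p [r [r0 wpr]]].
have c1 := lnorm_poly_ge1 R c0; have a1 := le_lt_trans c1 ca.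
have dN : N (po (M 1 0) * w + po (M 1 1)) = N (po (M 0 0)).
  by apply: (axis_den_norm NP) wE.
have detN := unitmx_detE R Mu.
move: dN detN; set a := M 0 0 in wE a1 *; set b := M 0 1 in wE *.
set c := M 1 0 in wE *; set d := M 1 1 in wE * => dN detN.
have bE : po b = po c * w ^+ 2 + (po d - po a) * w.
  by apply/esym/eqP; rewrite -subr_eq0 wE.
have aN : N (po a - po c * w) * N (po a) = 1.
  by rewrite -dN -(unM NP) -detN; congr N; rewrite bE; ring.
have H (k : nat) : exists p' r' : {poly F},
    [/\ r' != 0, w = po p' / po r' & N (po r') * N (po a) ^+ k = N (po r)].
  elim: k => [|k [p' [r' [r'0 wE' rN]]]]; first by exists p, r; rewrite mulr1.
  have pr0 : po r' != 0 by rewrite ls_poly_eq0.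
  have nE : po (a * r' - c * p') = po r' * (po a - po c * w).
    by rewrite rmorphB !rmorphM /= wE'; field.
  have aN0 : po a - po c * w != 0.
    by apply/eqP => E; move/eqP: aN; rewrite E (un0 NP) mul0r eq_sym oner_eq0.
  exists (d * p' - b * r'), (a * r' - c * p'); split.
  - by rewrite -ls_poly_eq0 nE mulf_neq0.
  - rewrite nE rmorphB !rmorphM /=.
    have -> : po p' = w * po r' by rewrite wE' divfK.
    rewrite bE; field; exact/andP.
  - by rewrite nE (unM NP) exprS -rN mulrA -[_ * _ * N (po a)]mulrA aN mulr1.
have [k kL] := expr_unbounded (N (po r)) a1.
have [p' [r' [r'0 _ rN]]] := H k.
have := kL k (leqnn k); rewrite ltNge -rN ler_peMl ?exprn_ge0 ?(un_ge0 NP) //.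
exact: lnorm_poly_ge1.
Qed.

Definition lfloor x : {poly F} := projT1 (cid (lnorm_floor R x)).

Lemma lfloorP x : N (x - po (lfloor x)) < 1.
Proof. exact: (projT2 (cid (lnorm_floor R x))). Qed.

Definition cf_mx (p : {poly F}) : 'M[{poly F}]_2 :=
  \matrix_(i, j) if i == 0 then (if j == 0 then p else 1) else (if j == 0 then 1 else 0).

Lemma cf_mxE p :
  (cf_mx p 0 0 = p) * (cf_mx p 0 1 = 1) * (cf_mx p 1 0 = 1) * (cf_mx p 1 1 = 0).
Proof. by rewrite !mxE. Qed.

Lemma cf_mx_unit p : cf_mx p \in unitmx.
Proof. by rewrite unitmxE det_mx2E !cf_mxE mulr0 mulr1 sub0r unitrN1. Qed.

Variable f : LS.
Hypothesis fK : ~ is_rational f.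

Fixpoint cfx n := if n is n'.+1 then (cfx n' - po (lfloor (cfx n')))^-1 else f.
Definition cfa n := lfloor (cfx n).
(** [cf_prod 0 n] is the matrix G_n with f = G_n x_n, and [cf_prod n k] is the return matrix G_n^-1
    G_(n+k). *)
Fixpoint cf_prod n k := if k is k'.+1 then cf_prod n k' *m cf_mx (cfa (n + k')) else 1%:M.

Lemma cfx_irrational n : ~ is_rational (cfx n).
Proof.
elim: n => //= n IH /rationalV; rewrite invrK => E; apply: IH.
by rewrite -(subrK (po (lfloor (cfx n))) (cfx n)); apply: rationalD => //;
  exact: rational_poly.
Qed.

Lemma cfx_frac_neq0 n : cfx n - po (lfloor (cfx n)) != 0.
Proof.
rewrite subr_eq0; apply/eqP => E; apply: (@cfx_irrational n); rewrite E.
exact: rational_poly.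
Qed.

Lemma cfx_gt1 n : 1 < N (cfx n.+1).
Proof.
by rewrite /= (unV NP) invf_gt1 ?lfloorP // (un_gt0 NP) // cfx_frac_neq0.
Qed.

Lemma cfx_step n : cfx n = mobM (cf_mx (cfa n)) (cfx n.+1).
Proof.
rewrite /mobM /mob !cf_mxE /= rmorph1 rmorph0 mul1r addr0 /cfa.
by rewrite invrK mulrDl mul1r divfK ?cfx_frac_neq0 // addrC subrK.
Qed.

Lemma cfa_ge2 n : 2 <= N (po (cfa n.+1)).
Proof.
have aN : 1 < N (po (cfa n.+1)).
  have -> : po (cfa n.+1) = cfx n.+1 - (cfx n.+1 - po (cfa n.+1)) by ring.
  by rewrite (unB_doml NP) ?cfx_gt1 // (lt_trans (lfloorP _)) // cfx_gt1.
have a0 : cfa n.+1 != 0 by apply/eqP => a0; move: aN; rewrite a0 rmorph0 (un0 NP) ltr10.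
move: aN; rewrite lnorm_poly //; case: (_.-1) => [|k _]; first by rewrite ltxx.
have q2 : 2 <= q by rewrite ler_nat card_finNzRing_gt1.
rewrite exprS (le_trans q2) // ler_peMr ?exprn_ege1 //; have := q2; lra.
Qed.

Lemma cf_prod_unit n k : cf_prod n k \in unitmx.
Proof. by elim: k => [|k IH]; rewrite /= ?unitmx1 // unitmx_mul IH cf_mx_unit. Qed.

Lemma cf_prod_add n k : cf_prod 0 (n + k) = cf_prod 0 n *m cf_prod n k.
Proof.
by elim: k => [|k IH] /=; rewrite ?addn0 ?mulmx1 // addnS /= IH -mulmxA add0n.
Qed.

Lemma cf_prod_mob n k : cfx n = mobM (cf_prod n k) (cfx (n + k)).
Proof.
elim: k => [|k IH]; first by rewrite addn0 mobM1.
rewrite IH addnS /= (mobM_mulE R) ?cf_prod_unit ?cf_mx_unit //; last first.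
  exact: (@cfx_irrational (n + k).+1).
by rewrite -cfx_step.
Qed.

(** The product starts at index n + 1 because the partial quotient of index 0 may be constant or
    zero. All later ones have norm at least 2, so the top left entry dominates at each step. *)
Lemma cf_prod_dominant n k : let M := cf_prod n.+1 k.+1 in
  [/\ N (po (M 0 1)) < N (po (M 0 0)), N (po (M 1 0)) < N (po (M 0 0)),
      N (po (M 1 1)) < N (po (M 0 0)) & 2 ^+ k.+1 <= N (po (M 0 0))].
Proof.
elim: k => [|k [ba ca da kM]].
  rewrite /= mul1mx !cf_mxE rmorph0 rmorph1 (un0 NP) (un1 NP) addn0.
  by have a2 := cfa_ge2 n; split; rewrite ?expr1 //; lra.
cbv zeta; rewrite -[cf_prod _ k.+2]/(cf_prod n.+1 k.+1 *m cf_mx (cfa (n.+1 + k.+1))).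
move: (cf_prod n.+1 k.+1) ba ca da kM => M ba ca da kM.
have A2 := cfa_ge2 (n + k.+1); rewrite -addSn in A2; set A := cfa _ in A2 *.
have aN : N (po (M 0 0) * po A + po (M 0 1)) = N (po (M 0 0)) * N (po A).
  by rewrite (unD_dom NP) (unM NP) //; have := un_ge0 NP (po (M 0 0)); nra.
have k0 : 0 < (2 : R) ^+ k.+1 by rewrite exprn_gt0.
rewrite !mulmx2E !cf_mxE !mulr1 !mulr0 !addr0 !rmorphD !rmorphM /= aN.
move: kM k0; rewrite [2 ^+ k.+2]exprSr; move: (2 ^+ k.+1) => T kM k0.
have ge0 := un_ge0 NP (po (M 0 0)).
split; try by nra.
by apply: (unD_lt NP); rewrite ?(unM NP); nra.
Qed.

Lemma cf_prod_bottom n : let M := cf_prod 0 n.+1 in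
  N (po (M 1 1)) < N (po (M 1 0)) /\ 2 ^+ n <= N (po (M 1 0)).
Proof.
elim: n => [|n [dc nM]].
  by rewrite /= mul1mx !cf_mxE rmorph0 rmorph1 (un0 NP) (un1 NP) expr0.
cbv zeta; rewrite -[cf_prod _ n.+2]/(cf_prod 0 n.+1 *m cf_mx (cfa (0 + n.+1))) add0n.
move: (cf_prod 0 n.+1) dc nM => M dc nM.
have A2 := cfa_ge2 n; set A := cfa _ in A2 *.
have cN : N (po (M 1 0) * po A + po (M 1 1)) = N (po (M 1 0)) * N (po A).
  by rewrite (unD_dom NP) (unM NP) //; have := un_ge0 NP (po (M 1 0)); nra.
have n0 : 0 < (2 : R) ^+ n by rewrite exprn_gt0.
rewrite !mulmx2E !cf_mxE !mulr1 !mulr0 !addr0 !rmorphD !rmorphM /= cN exprSr.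
by move: nM n0; move: (2 ^+ n) => T nM n0; split; nra.
Qed.

(** The pole G_n^-1 oo of G_n, minus a ratio of consecutive continuant denominators. *)
Definition cfy n := - po (cf_prod 0 n 1 1) / po (cf_prod 0 n 1 0).

Lemma cfy_lt1 n : N (cfy n.+1) < 1.
Proof.
have [dc nM] := cf_prod_bottom n.
have c0 : 0 < N (po (cf_prod 0 n.+1 1 0)) by exact: le_lt_trans (un_ge0 NP _) dc.
by rewrite /cfy (un_div NP) (unN NP) ltr_pdivrMr // mul1r.
Qed.

(** As G_(n+k) = G_n M, the matrix M sends the pole of G_(n+k) to that of G_n. *)
Lemma cfy_step n k : let M := cf_prod n.+1 k in
  po (M 1 0) * cfy (n.+1 + k) + po (M 1 1) != 0 /\ mobM M (cfy (n.+1 + k)) = cfy n.+1.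
Proof.
move=> M.
have c0 m : po (cf_prod 0 m.+1 1 0) != 0.
  have [dc _] := cf_prod_bottom m; apply/eqP => E; move: dc.
  by rewrite E (un0 NP) ltNge (un_ge0 NP).
have := c0 (n + k); rewrite -addSn /cfy cf_prod_add -/M.
have := c0 n; move: (cf_prod 0 n.+1) => G.
rewrite !mulmx2E !rmorphD !rmorphM /= => g0 g0'.
have D0 : po (M 0 0) * po (M 1 1) - po (M 0 1) * po (M 1 0) != 0.
  have := unitmx_detE R (cf_prod_unit n.+1 k); rewrite -/M => DN.
  by apply/eqP => E; move/eqP: DN; rewrite E (un0 NP) eq_sym oner_eq0.
set r := po (G 1 0) in g0 g0' *; set r' := po (G 1 1) in g0' *.
set a := po (M 0 0) in D0 g0' *; set b := po (M 0 1) in D0 *.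
set c := po (M 1 0) in D0 g0' *; set d := po (M 1 1) in D0 *.
have dE : c * (- (r * b + r' * d) / (r * a + r' * c)) + d
   = r * (a * d - b * c) / (r * a + r' * c) by field.
have nE : a * (- (r * b + r' * d) / (r * a + r' * c)) + b
   = - r' * (a * d - b * c) / (r * a + r' * c) by field.
split; first by rewrite dE !mulf_neq0 ?invr_eq0.
rewrite /mobM /mob -/a -/b -/c -/d dE nE.
rewrite -mulf_div divff ?invr_eq0 // mulr1 -mulf_div divff // mulr1 //.
Qed.

Lemma cf_return n k : exists2 M, M \in unitmx &
  [/\ N (po (M 0 1)) < N (po (M 0 0)), N (po (M 1 0)) < N (po (M 0 0)),
      N (po (M 1 1)) < N (po (M 0 0)) & 2 ^+ k.+1 <= N (po (M 0 0))] /\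
  [/\ mobM M (cfx (n.+1 + k.+1)) = cfx n.+1, mobM M (cfy (n.+1 + k.+1)) = cfy n.+1
    & po (M 1 0) * cfy (n.+1 + k.+1) + po (M 1 1) != 0].
Proof.
exists (cf_prod n.+1 k.+1); first exact: cf_prod_unit.
split; first exact: cf_prod_dominant.
by have [? ?] := cfy_step n k.+1; split => //; rewrite -cf_prod_mob.
Qed.

End ContinuedFraction.

(** * From a recurrence of the expansion to a quadratic series *)

Lemma infinitely_often (T : finType) (s : nat -> T) :
  exists t, forall n, exists2 m, (n <= m)%N & s m = t.
Proof.
apply: contrapT => nH.
have bounded t : exists n, forall m, (n <= m)%N -> s m <> t.
  apply: contrapT => nB; apply: nH; exists t => n; apply: contrapT => nE.
  by apply: nB; exists n => m nm sm; apply: nE; exists m.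
have [g gP] := choice bounded.
by apply: (gP (s (\max_t g t)) (\max_t g t)) => //; apply: leq_bigmax.
Qed.

Section QuadraticApproximation.
Variables (F : finFieldType) (R : realType).
Local Notation LS := (laurent_series F).
Local Notation N := (@lnorm F R).
Local Notation po := (@ls_poly F).
Local Notation q := (#|F|%:R : R).
Implicit Types (x y z w : LS).
Let NP := lnorm_ultrametric F R.

(** The coefficients of Y^-1, ..., Y^-L: finitely many values, and for points of the open unit ball
    they determine the point up to q^-(L+1). *)
Definition window (L : nat) x : {ffun 'I_L -> F} := [ffun i : 'I_L => x (- i.+1%:Z)].

Lemma window_close L x y : N x < 1 -> N y < 1 -> window L x = window L y ->
  N (x - y) <= (q ^+ L.+1)^-1.
Proof.
move=> /small_lnorm xS /small_lnorm yS xy.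
have -> : (q ^+ L.+1)^-1 = q ^ (- L.+1%:Z) by rewrite exprnN.
apply/lnorm_le => n nL; rewrite lcoefB.
have [n0|n0] := leP 0 n.
  have n1 : -1 < n by lia.
  by rewrite xS // yS // subrr.
have iL : ((absz n).-1 < L)%N by lia.
have := congr1 (fun h : {ffun 'I_L -> F} => h (Ordinal iL)) xy; rewrite !ffunE /=.
by rewrite (_ : - _ = n); [move=> ->; rewrite subrr | lia].
Qed.

Lemma quadratic_liminf (al al' f : LS) (kap : R) : conjugate al al' ->
  ~ is_rational f -> (forall f', ~ conjugate f f') ->
  (forall z, ~ orbit_pair al al' f z) -> 0 < kap ->
  liminf_rho N (orbit_pair al al') kap f ->
  exists w w', [/\ conjugate w w', forall z, ~ orbit_pair al al' w z
    & liminf_rho N (orbit_pair al al') kap w].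
Proof.
move=> ca fK fQ fT kap0 [[eps0 eps00 H1] H2].
have q1 := card_gt1 F R.
(* L is large enough that the precision del is below 1 and at most kap. *)
have [L LP] := expr_unbounded (Num.max 1 kap^-1) q1.
pose del := (q ^+ L.+1)^-1.
have := LP L.+1 (leqnSn L); rewrite gt_max => /andP[qL1 qLk].
have qL0 : 0 < q ^+ L.+1 by exact: lt_trans qL1.
have del0 : 0 < del by rewrite invr_gt0.
have del1 : del < 1 by rewrite invf_lt1.
have delk : del <= kap by rewrite -[kap]invrK lef_pV2 ?posrE ?invr_gt0 // ltW.
pose X n := cfx R f n.+1; pose Y n := cfy R f n.+1; pose G n := cf_prod R f 0 n.+1.
have X1 n : 1 < N (X n) by exact: cfx_gt1.
have Y1 n : N (Y n) < 1 by exact: cfy_lt1.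
have XK n : ~ is_rational (X n) by exact: cfx_irrational.
have YK n : is_rational (Y n).
  by apply: rational_div; [apply: rationalN|]; exact: rational_poly.
have Gu n : G n \in unitmx by exact: cf_prod_unit.
have fE n : f = mobM (G n) (X n) by exact: (cf_prod_mob R fK 0 n.+1).
have [t tinf] := infinitely_often (fun n => (window L (Y n), window L (X n)^-1)).
have [dl dl0 LF] := orbit_pair_locally_finite ca fT eps00.
(* The first index n is taken so large that 1/|c|^2, for c the lower left entry of G_n, is below the
   threshold of the lower bound and that of local finiteness. *)
pose mu := Num.min eps0 dl; have mu0 : 0 < mu by rewrite lt_min eps00.
have [n0 n0P] := expr_unbounded (mu^-1) (ltr1n R 2).
have [n nn0 nt] := tinf n0.
have [Gdc Gn] := cf_prod_bottom R fK n; rewrite -/(G n) in Gdc Gn.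
have G2 : (N (po (G n 1 0)) ^+ 2)^-1 < mu.
  have c1 : 1 <= N (po (G n 1 0)) by apply: le_trans Gn; rewrite exprn_ege1 // ler1n.
  have cmu : mu^-1 < N (po (G n 1 0)) by apply: lt_le_trans Gn; exact: n0P.
  rewrite -[mu]invrK ltf_pV2 ?posrE ?invr_gt0 ?exprn_gt0 ?(lt_le_trans _ c1) //.
  by rewrite expr2; nra.
have g30 : po (G n 1 0) != 0.
  by apply/eqP => E; move: Gdc; rewrite E (un0 NP) ltNge (un_ge0 NP).
have gN := unitmx_detE R (Gu n).
set x := X n in nt; have x1 := X1 n; rewrite -/x in x1.
have xn0 : 0 < N x by exact: lt_trans x1.
have cn0 : 0 < N (po (G n 1 0)) by exact: (un_gt0 NP).
have irr_neq z y : ~ is_rational z -> is_rational y -> z != y.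
  by move=> zK yK; apply/eqP => E; apply: zK; rewrite E.
(* A point within eta of f pulls back by G_n to a point at distance less than |x| from x. *)
pose eta := (N x * N (po (G n 1 0)) ^+ 2)^-1.
have eta0 : 0 < eta by rewrite invr_gt0 mulr_gt0 // exprn_gt0.
have pull z : ~ is_rational z -> N (f - mobM (G n) z) < eta -> N (z - x) < N x.
  move=> zK; rewrite [in X in X -> _](fE n) -/x.
  rewrite (mob_dist NP gN g30) ?irr_neq //; try exact: YK; try exact: XK.
  rewrite -/(Y n) => zs; rewrite ltNge; apply/negP => xz; move: zs.
  have xy : N (x - Y n) = N x by rewrite (unB_doml NP) // (lt_trans (Y1 n)).
  have zx0 : 0 < N (x - z) by rewrite (unBC NP) (lt_le_trans xn0).
  have zy0 : 0 < N (z - Y n) by apply: (un_sub_eq0 NP); exact: irr_neq.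
  have zy : N (z - Y n) <= N (x - z).
    have -> : z - Y n = (x - Y n) - (x - z) by ring.
    by apply: (unB_le NP) => //; rewrite xy (unBC NP x).
  rewrite xy ltNge => /negP; apply.
  rewrite /eta invfM ler_pM2r ?invr_gt0 ?exprn_gt0 //.
  rewrite ler_pdivlMr ?mulr_gt0 // mulrA mulVf ?gt_eqF // mul1r //.
(* A realizing pair shorter than eta / mk has both points within eta of f. *)
pose mk := Num.max kap 1; have mk0 : 0 < mk by rewrite lt_max ltr01 orbT.
have [b [b' [Pb bs rb]]] := H2 (eta / mk) (divr_gt0 eta0 mk0).
have [z [z' [Pz zb zb']]] := orbit_pair_inv R ca (Gu n) Pb.
have pairK t1 t2 : orbit_pair al al' t1 t2 -> ~ is_rational t1 /\ ~ is_rational t2.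
  move=> /(orbit_pair_conj R ca) ct.
  by have [? _ _ _] := ct; have [? _ _ _] := conjugate_sym ct.
have [zK zK'] := pairK _ _ Pz.
have pair_neq t1 t2 : orbit_pair al al' t1 t2 -> t1 != t2.
  by move=> /(orbit_pair_conj R ca) [].
have bs' : mk * N (b - b') < eta by rewrite -ltr_pdivlMl // mulrC.
have bb0 := un_sub_eq0 NP (pair_neq _ _ Pb).
have fb : N (f - b) < eta.
  apply: le_lt_trans bs'; rewrite -ler_pdivrMr // -/(rho_oo N f b b') rb.
  by rewrite le_max lexx.
have fb' : N (f - b') < eta.
  have -> : f - b' = (f - b) - (b' - b) by ring.
  apply: (unB_lt NP) => //; apply: le_lt_trans bs'; rewrite (unBC NP b').
  by rewrite ler_peMl ?(un_ge0 NP) // le_max lexx orbT.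
have zx1 : N (z - x) < N x by apply: pull => //; rewrite zb.
have zx1' : N (z' - x) < N x by apply: pull => //; rewrite zb'.
have zx : z != x.
  by apply/eqP => E; apply: (fT b'); rewrite (fE n) -/x -E zb.
have rz : rho N (Y n) x z z' = kap.
  rewrite -rb -zb -zb' (fE n) -/x (rho_oo_mob NP gN g30) ?irr_neq //;
    first [exact: XK | exact: YK].
have zx0 := un_sub_eq0 NP zx.
(* The second index is chosen after the realizing pair, so that the multiplier is large compared
   with |x|^2 / |z - x|. *)
have [k0 k0P] := expr_unbounded (N x ^+ 2 / N (z - x)) (ltr1n R 2).
have [m mn mt] := tinf (n + k0.+1)%N.
have [k kE kk0] : exists2 k : nat, m = (n + k.+1)%N & (k0 <= k)%N.
  by clear -mn; exists (m - n).-1; lia.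
have mE : m.+1 = (n.+1 + k.+1)%N by rewrite kE; exact: erefl.
have [H Hu [[Hba Hca Hda Hk] [hxs hys dys]]] := cf_return R fK n k.
rewrite -mE in hxs hys dys.
have Hdet := unitmx_detE R Hu.
have Ha1 : 1 < N (po (H 0 0)).
  by apply: (lt_le_trans _ Hk); rewrite exprn_egt1 // ltr1n.
(* Otherwise the determinant would be the product of entries of norm > 1 and of norm 0 or >= 1. *)
have Hc0 : H 1 0 != 0.
  apply/eqP => E; move: Hdet; rewrite E rmorph0 mulr0 subr0 (unM NP) => ad1.
  have [d0|d0] := eqVneq (H 1 1) 0.
    by move/eqP: ad1; rewrite d0 rmorph0 (un0 NP) mulr0 eq_sym oner_eq0.
  by have := lnorm_poly_ge1 R d0; nra.
have Hc1 := lnorm_poly_ge1 R Hc0.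
have Hcp : po (H 1 0) != 0 by rewrite ls_poly_eq0.
have [w w1 wE] := hyperbolic_fixpoint Hba Hca Hda Hcp.
have wK := hyperbolic_fixpoint_irrational Hu Hba Hca Hda Hc0 w1 wE.
pose e := (po (H 0 0) - po (H 1 1)) / po (H 1 0) - w.
have ew : N (e - w) = N w by apply: (axis_ew_norm NP) wE.
have cw : conjugate w e.
  split => //.
  - by apply/eqP => E; move: ew; rewrite -E subrr (un0 NP); lra.
  - rewrite /e addrC subrK; apply: rational_div; last exact: rational_poly.
    by apply: rationalB; exact: rational_poly.
  - have -> : w * e = - po (H 0 1) / po (H 1 0).
      have -> : po (H 0 1) = po (H 1 0) * w ^+ 2 + (po (H 1 1) - po (H 0 0)) * w.
        by apply/esym/eqP; rewrite -subr_eq0 wE.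
      by rewrite /e; field.
    by apply: rational_div; [apply: rationalN|]; exact: rational_poly.
(* If x = w, then f = G_n w would be quadratic. *)
have xw : x != w.
  apply/eqP => E; apply: (fQ (mobM (G n) e)); rewrite (fE n) -/x E.
  exact: (conjugate_mobM R).
have dxs := den_neq0 R Hu (XK m).
have [dy dx] : N (Y n - Y m) <= del /\ N (x^-1 - (X m)^-1) <= del.
  have : (window L (Y n), window L x^-1) = (window L (Y m), window L (X m)^-1).
    by rewrite mt.
  move=> [Ey Ex]; split; apply: window_close => //; rewrite (unV NP) invf_lt1 //.
    exact: lt_trans (X1 m).
have Lx : N x ^+ 2 < N (po (H 0 0)) ^+ 2 * N (z - x).
  rewrite -ltr_pdivrMr //; apply: (lt_le_trans (k0P k.+1 (leqW kk0))).
  by apply: (le_trans Hk); rewrite expr2 ler_peMr // ltW // (lt_trans _ Ha1).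
have [|||||||wT wL] := @shadowing _ _ _ NP _ _ _ _ w Hdet Hba Hca Hda Hc1 w1 wE
  _ _ _ _ x (X m) (Y m) del gN g30 (Y1 n) x1 (X1 m) (Y1 m) hxs hys dxs dys dx dy
  del0 del1 xw (orbit_pair al al') kap eps0 (@orbit_pair_sym _ al al') pair_neq _ _ _ _ delk _ _ _
  z z' Pz zx rz zx1 zx1' Lx.
- move=> t1 t2 Pt; have [tK _] := pairK _ _ Pt.
  by split; [apply: irr_neq; [|exact: YK]|exact: (orbit_pair_mobM R)].
- move=> t1 t2 Pt; have [tK _] := pairK _ _ Pt.
  by split; [exact: (den_neq0 R Hu)|exact: (orbit_pair_mobM R)].
- by move=> t1 t2; exact: (orbit_pair_inv R).
- by move=> t1 /(orbit_pair_conj R ca) /conjugate_uniq; apply.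
- by apply: (lt_le_trans G2); rewrite ge_min lexx.
- by move=> t1 t2 Pt; rewrite -[mob _ _ _ _ x](fE n); exact: H1.
- move=> t1 t2 Pt; rewrite -[mob _ _ _ _ x](fE n) => /le_lt_trans ft; apply: (LF _ _ Pt).
  by apply: ft; apply: (lt_le_trans G2); rewrite ge_min lexx orbT.
by exists w, e.
Qed.

End QuadraticApproximation.

(** * Approximation constants *)

Section ApproximationConstant.
Variables (F : finFieldType) (R : realType).
Local Notation LS := (laurent_series F).
Local Notation N := (@lnorm F R).
Local Notation q := (#|F|%:R : R).
Let NP := lnorm_ultrametric F R.

Lemma rho_oo_discrete (f z z' : LS) (d : int) : z != z' ->
  q ^ d < rho_oo N f z z' -> q ^ (d + 1) <= rho_oo N f z z'.
Proof.
rewrite /rho_oo => zz; have [->|fz] := eqVneq (f - z) 0.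
  by rewrite (un0 NP) mul0r ltNge ltW // exprq_gt0.
have zz0 : z - z' != 0 by rewrite subr_eq0.
have [a aE] := lnorm_ex R fz; have [b bE] := lnorm_ex R zz0.
rewrite aE bE invr_expz -expfzDr; last first.
  by rewrite gt_eqF // (lt_trans _ (card_gt1 F R)).
by rewrite ltr_eXz2l ?card_gt1 // ler_eXz2l ?card_gt1 //; lia.
Qed.

Lemma calphaP (al al' f : LS) (m : int) : conjugate al al' ->
  calpha R al f = (q ^ (- m))%:E <->
  liminf_rho N (orbit_pair al al') (q ^ (- m)) f.
Proof.
move=> ca; set k := q ^ (- m); rewrite /calpha.
pose T eps := [set beta | Theta al beta /\ labs R (lsub beta (galconj beta)) < eps].
pose I eps := ereal_inf [set ((labs R (lsub f beta)) /
  (labs R (lsub beta (galconj beta))))%:E | beta in T eps].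
pose S := [set I eps | eps in [set eps : R | 0 < eps]]; rewrite -/(ereal_sup S).
have TP eps z z' : orbit_pair al al' z z' -> N (z - z') < eps ->
    [set ((labs R (lsub f beta)) / (labs R (lsub beta (galconj beta))))%:E
      | beta in T eps] (rho_oo N f z z')%:E.
  move=> Pz zeps; have gz := conjugate_galconj (orbit_pair_conj R ca Pz).
  exists (lcoef z); last by rewrite gz.
  by split; [apply/(ThetaP R z ca); exists z' | rewrite gz].
have IP eps y : [set ((labs R (lsub f beta)) / (labs R (lsub beta (galconj beta))))%:E
      | beta in T eps] y ->
    exists z z', [/\ orbit_pair al al' z z', N (z - z') < eps & y = (rho_oo N f z z')%:E].
  move=> [beta [tb be] <-]; have bL : laurent beta by case: tb.
  pose z := LaurentSeries bL; have [z' Pz] := (ThetaP R z ca).1 tb.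
  have gz := conjugate_galconj (orbit_pair_conj R ca Pz).
  by move: be; rewrite -[beta]/(lcoef z) gz => be; exists z, z'.
have q1 := card_gt1 F R; have k0 : 0 < k by exact: exprq_gt0.
have pneq z z' : orbit_pair al al' z z' -> z != z' by move=> /(orbit_pair_conj R ca)[].
split=> [supE|[[eps0 eps00 H1] H2]]; last first.
  apply/eqP; rewrite eq_le; apply/andP; split.
    apply: ge_ereal_sup => _ [eps /= eps_gt0 <-].
    have [z [z' [Pz zs <-]]] := H2 _ eps_gt0.
    exact: (ereal_inf_lbound (TP _ _ _ Pz zs)).
  apply: le_ereal_sup_tmp; exists (I eps0); first by exists eps0.
  apply: le_ereal_inf_tmp => y /IP[z [z' [Pz zs ->]]].
  by rewrite lee_fin; exact: H1.
have H1 : exists2 eps, 0 < eps &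
    forall z z', orbit_pair al al' z z' -> N (z - z') < eps -> k <= rho_oo N f z z'.
  (* Some infimum exceeds q^(-m-1), and by discreteness all its terms are then at least q^(-m). *)
  have : ((q ^ (- m - 1))%:E < ereal_sup S)%E.
    by rewrite supE lte_fin ltr_eXz2l //; lia.
  move=> /ereal_sup_gt[_ [eps /= eps_gt0 <-] Ieps]; exists eps => // z z' Pz zs.
  have -> : k = q ^ (- m - 1 + 1) by rewrite subrK.
  apply: rho_oo_discrete; first exact: pneq Pz.
  by rewrite -lte_fin; exact: lt_le_trans Ieps (ereal_inf_lbound (TP _ _ _ Pz zs)).
split => // eps eps_gt0; have [eps0 eps00 H1'] := H1.
apply: contrapT => nE.
pose eps1 := Num.min eps eps0; have eps10 : 0 < eps1 by rewrite lt_min eps_gt0.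
(* If no pair shorter than eps attains k, discreteness raises all short terms to q^(-m+1), too large
   for the supremum. *)
have : (ereal_sup S < (q ^ (- m + 1))%:E)%E.
  by rewrite supE lte_fin ltr_eXz2l //; lia.
rewrite ltNge => /negP; apply; apply: le_ereal_sup_tmp.
exists (I eps1); first by exists eps1.
apply: le_ereal_inf_tmp => y /IP[z [z' [Pz zs ->]]]; rewrite lee_fin.
move: zs; rewrite lt_min => /andP[zs1 zs2].
apply: rho_oo_discrete; first exact: pneq Pz.
rewrite lt_neqAle H1' // andbT; apply/eqP => E; apply: nE.
by exists z, z'; split => //; exact: esym E.
Qed.

End ApproximationConstant.

Theorem theorem1p3 (F : finFieldType) (R : realType) (alpha : lser F) (m : int) :
  quadratic alpha ->
  Sp R alpha ((#|F|%:R : R) ^ (- m))%:E ->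
  exists f : lser F, quadratic f /\ ~ Theta alpha f /\
    calpha R alpha f = ((#|F|%:R : R) ^ (- m))%:E.
Proof.
move=> alQ [f [fL [fK fT]] fE]; have alL : laurent alpha by case: alQ.
move: alQ fK fT fE; rewrite -[alpha]/(lcoef (LaurentSeries alL)).
rewrite -[f]/(lcoef (LaurentSeries fL)).
move: (LaurentSeries alL) (LaurentSeries fL) => al g.
move=> /(quadraticP R)[al' ca] fK fT fE.
(* A quadratic witness can be kept as it is; otherwise its expansion provides the fixed point w. *)
have [gQ|gQ] := pselect (quadratic g); first by exists g.
have [||||w [w' [cw wT wL]]] := @quadratic_liminf F R al al' g _ ca _ _ _ _ ((calphaP R g m ca).1 fE).
- by move=> /inK_rational.
- by move=> f' cf; apply: gQ; apply/(quadraticP R); exists f'.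
- by move=> z Pz; apply: fT; apply/(ThetaP R g ca); exists z.
- exact: exprq_gt0.
exists (lcoef w); split; first by apply/(quadraticP R); exists w'.
split; last exact/(calphaP R w m ca).
by move=> /(ThetaP R w ca)[z]; exact: wT.
Qed.
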